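(* Let $(X,T)$ and $(Y,S)$ be topological dynamical systems and let $\xi$ be a $(T\times S)$-invariant Borel probability measure on the product system $(X\times Y,T\times S)$, with marginals $\mu$ on $X$ and $\nu$ on $Y$. Assume that $(X,T)$ has the weak specification property and that $\mu$ is ergodic under $T$. Suppose also that $y\in Y$ is quasi-generic for $\nu$ (under $S$). Then there exists a point $x\in X$, generic for $\mu$ (under $T$), such that the pair $(x,y)$ is quasi-generic for $\xi$ (under $T\times S$).
   Context: A topological dynamical system $(X,T)$ consists of a compact metric space $(X,d)$ and a continuous surjection $T:X\to X$. Measures are Borel probability measures; the space of measures carries the weak* topology. Empirical measures: for $x\in X$ and integers $0\le a\le b$, $[a,b]$ denotes $\{a,a+1,\dots,b\}$ and $\mu_{x[a,b]}=\frac1{b-a+1}\sum_{n=a}^b\delta_{T^nx}$. A point $x$ is quasi-generic for a measure $\mu$ if $\mu$ is a weak* accumulation point of the sequence $(\mu_{x[0,n]})_{n\ge1}$, i.e. if there is an increasing sequence $(n_k)_{k\ge1}$ of natural numbers with $\mu_{x[0,n_k]}\to\mu$. The point $x$ is generic for $\mu$ if $\mu_{x[0,n]}\to\mu$ as $n\to\infty$. The same notions are used in $(Y,S)$ and $(X\times Y,T\times S)$. Finite specification: given nonnegative integers $a_1\le b_1<a_2\le b_2<\dots<a_{N_1}\le b_{N_1}$ and $D=\bigcup_{N=1}^{N_1}[a_N,b_N]$, a specification with domain $D$ is a function $\mathcal S:D\to X$ such that for each $N$ there is a point $x_N\in X$ with $\mathcal S(n)=T^n(x_N)$ for all $n\in[a_N,b_N]$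 (equivalently, since $T$ is surjective, one may require $\mathcal S(n)=T^{n-a_N}(x_N)$). Its orbit segment lengths are $l_N=b_N-a_N+1$ and its gaps are $g_N=a_{N+1}-b_N-1$. A point $x\in X$ $\varepsilon$-shadows $\mathcal S$ if $d(\mathcal S(n),T^nx)<\varepsilon$ for all $n\in D$. $(X,T)$ has the weak specification property if for every $\varepsilon>0$ there is a function $M_\varepsilon:\mathbb N\to\mathbb N$ with $\lim_{l\to\infty}M_\varepsilon(l)/l=0$ such that every finite specification (with any finite number $N_1$ of orbit segments) satisfying $g_N\ge M_\varepsilon(l_{N+1})$ for each $N\in[1,N_1-1]$ is $\varepsilon$-shadowed by some point of $X$. *)

(* Defs.v *)
From HB Require Import structures.
From mathcomp Require Import all_boot all_order all_algebra.
From mathcomp Require Import all_classical all_reals all_analysis.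
Import Order.TTheory GRing.Theory Num.Theory.
Import numFieldNormedType.Exports.

Set Implicit Arguments.
Unset Strict Implicit.
Unset Printing Implicit Defensive.

Local Open Scope classical_set_scope.
Local Open Scope ring_scope.

(* The library's generated sigma-algebras live on pointed types, hence nonempty
   metric spaces. *)
#[short(type="pmetricType")]
HB.structure Definition PointedMetric (K : numDomainType) :=
  { M of Metric K M & Pointed M }.

HB.instance Definition _ (X Y : ptopologicalType) := Pointed.on (X * Y)%type.

Definition borel (Z : ptopologicalType) := g_sigma_algebraType (@open Z).

HB.instance Definition _ (Z : ptopologicalType) := Measurable.on (borel Z).

Definition tds (R : realType) (X : pmetricType R) (T : X -> X) : Prop :=
  [/\ compact [set: X], continuous T & set_surj [set: X] [set: X] T].

Definition prod_map (X Y : Type) (T : X -> X) (S : Y -> Y) : X * Y -> X * Y :=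
  fun z => (T z.1, S z.2).

Section Measures.
Variables (R : realType) (Z : ptopologicalType).
Implicit Types (T : Z -> Z) (z : Z) (mu : probability (borel Z) R).

(* Equality is only required on Borel sets: a library measure is a function on
   all subsets. *)
Definition invariant_measure T mu : Prop :=
  forall A : set (borel Z), measurable A -> mu (T @^-1` A) = mu A.

Definition ergodic T mu : Prop :=
  invariant_measure T mu /\
  forall A : set (borel Z), measurable A -> T @^-1` A = A ->
    mu A = 0%E \/ mu A = 1%E.

(* The uniform measure on the orbit segment T^a z, ..., T^b z, for a <= b. *)
Definition emp T z (a b : nat) : set (borel Z) -> \bar R :=
  mscale ((b - a).+1%:R^-1)%:nng
    (msum (fun k => \d_(iter (a + k) T z : borel Z)) (b - a).+1).

HB.instance Definition _ T z a b := Measure.on (emp T z a b).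

Lemma emp_setT T z a b : emp T z a b [set: borel Z] = 1%E.
Proof.
have -> : emp T z a b [set: borel Z] =
    ((b - a).+1%:R^-1%:E * \sum_(k < (b - a).+1) 1)%E.
  by congr (_ * _)%E; apply: eq_bigr => k _; exact: diracT.
by rewrite sumEFin -EFinM sumr_const card_ord mulVf// pnatr_eq0.
Qed.

HB.instance Definition _ T z a b :=
  Measure_isProbability.Build _ _ _ (emp T z a b) (emp_setT T z a b).

(* Used on compact spaces only, where every continuous f is bounded. *)
Definition weak_star_cvg (mu_ : (probability (borel Z) R)^nat) mu : Prop :=
  forall f : Z -> R, continuous f ->
    (fun n => \int[mu_ n]_x f x) @ \oo --> \int[mu]_x f x.

Definition generic T z mu : Prop := weak_star_cvg (emp T z 0) mu.

Definition quasi_generic T z mu : Prop :=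
  exists n_ : nat -> nat, {homo n_ : i j / (i < j)%N} /\
    weak_star_cvg (fun k => emp T z 0 (n_ k)) mu.

End Measures.

Definition marginals (R : realType) (X Y : ptopologicalType)
    (xi : probability (borel (X * Y)%type) R)
    (mu : probability (borel X) R) (nu : probability (borel Y) R) : Prop :=
  (forall A : set (borel X), measurable A -> xi (fst @^-1` A) = mu A) /\
  (forall B : set (borel Y), measurable B -> xi (snd @^-1` B) = nu B).

Section Specification.
Variables (R : realType) (X : pmetricType R) (T : X -> X).
Implicit Types (K : nat) (a b : nat -> nat) (Sp : nat -> X).

Definition spec_domain K a b : set nat :=
  [set n | exists2 N, (N < K)%N & (a N <= n <= b N)%N].

(* The K orbit segments are indexed from 0; only the values of a and b below
   K, and those of Sp on spec_domain K a b, are relevant. *)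
Definition specification K a b Sp : Prop :=
  [/\ (0 < K)%N,
      forall N, (N < K)%N -> (a N <= b N)%N,
      forall N, (N.+1 < K)%N -> (b N < a N.+1)%N &
      forall N, (N < K)%N -> exists x : X,
        forall n, (a N <= n <= b N)%N -> Sp n = iter n T x].

Definition seg_length a b N : nat := (b N - a N).+1.

Definition gap a b N : nat := (a N.+1 - b N - 1)%N.

Definition shadows (e : R) K a b Sp (x : X) : Prop :=
  forall n, spec_domain K a b n -> mdist (Sp n) (iter n T x) < e.

Definition weak_specification : Prop :=
  forall e : R, 0 < e -> exists M : nat -> nat,
    (fun l => (M l)%:R / l%:R : R) @ \oo --> (0 : R) /\
    forall K a b Sp, specification K a b Sp ->
      (forall N, (N.+1 < K)%N -> (M (seg_length a b N.+1) <= gap a b N)%N) ->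
      exists x : X, shadows e K a b Sp x.

End Specification.

(* Main.v *)
(* The point x is the limit of points z_k, where z_(k+1) follows z_k up to a time
   t_k and afterwards follows a concatenation of long orbit blocks of X separated
   by relatively short gaps; weak specification provides such a point, and the
   long initial segment costs nothing because the required gap depends only on
   the length of the segment after it.  Each block starts at a point whose
   averages over the block are close to mu (ergodic theorem), so x is generic for
   mu.  The block starting at time p is drawn from the conditional law of xi given
   the second coordinate S^p y, smoothed by partitions of unity.  The expected
   pair average over a block, seen from a uniformly distributed starting time, is
   close to xi because y is quasi-generic for nu.  Since S^p y need not be
   equidistributed along an arithmetic progression of starting times p, time is
   cut into long stretches and the offset of the blocks is chosen anew in each.
   The random choices of offsets and blocks are made deterministically by a greedy
   rule which never lets the discrepancy grow faster than the square root of the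
   number of stretches. *)

Require Import Defs.
From mathcomp Require Import all_boot all_order all_algebra.
From mathcomp Require Import all_classical all_reals all_analysis.
From mathcomp Require Import measurable_realfun zify ring lra.
Import Order.TTheory GRing.Theory Num.Theory.
Import numFieldNormedType.Exports.

Set Implicit Arguments.
Unset Strict Implicit.
Unset Printing Implicit Defensive.

Local Open Scope classical_set_scope.
Local Open Scope ring_scope.

(** * Integrals of continuous functions on compact spaces *)

Section ProbabilityIntegrals.
Context d (T : measurableType d) (R : realType) (P : probability T R).
Implicit Types (f : T -> R).

Lemma Rintegral_probability_cst (r : R) : \int[P]_x r = r.
Proof. by rewrite Rintegral_cst// [X in fine X](probability_setT P) mulr1. Qed.

(** The function [|f|] is dominated by [e] plus [C] times the indicator of the complement of [A],
    whose mass is at most [eta]. *)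
Lemma norm_Rintegral_le f (A : set T) (e C eta : R) :
  P.-integrable [set: T] (EFin \o f) -> measurable A ->
  (forall x, A x -> `|f x| <= e) -> (forall x, `|f x| <= C) ->
  0 <= e -> 0 <= C -> (P (~` A) <= eta%:E)%E ->
  `|\int[P]_x f x| <= e + C * eta.
Proof.
move=> intf mA fA fC e0 C0 Aeta.
have mAC : measurable (~` A) by exact: measurableC.
have intC : P.-integrable [set: T] (EFin \o (fun x => C * \1_(~` A) x)).
  apply: (@integrableZl _ _ _ _ _ _ C (EFin \o \1_(~` A))) => //.
  by apply: integrable_indic => //; rewrite setTI.
have intc : P.-integrable [set: T] (EFin \o cst e).
  exact: finite_measure_integrable_cst.
apply: (@le_trans _ _ (\int[P]_x (e + C * \1_(~` A) x))).
  apply: (le_trans (le_normr_Rintegral measurableT intf)).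
  apply: le_Rintegral => //.
  - exact: (integrable_norm intf).
  - exact: (integrableD measurableT intc intC).
  move=> x _; rewrite indicE.
  have [xA|xA] := boolP (x \in ~` A).
    by rewrite mulr1 (le_trans (fC x))// lerDr.
  rewrite mulr0 addr0; apply: fA; rewrite -[A]setCK; move: xA; rewrite notin_setE.
  exact.
rewrite RintegralD// Rintegral_probability_cst lerD2l RintegralZl//; last first.
  by apply: integrable_indic => //; rewrite setTI.
apply: ler_wpM2l => //.
rewrite /Rintegral integral_indic// setIT -lee_fin fineK// fin_num_measure//.
Qed.

End ProbabilityIntegrals.

Section ContinuousIntegrals.
Context (R : realType) (Z : ptopologicalType).
Hypothesis cZ : compact [set: Z].
Implicit Types (f g : Z -> R) (mu : probability (borel Z) R).

Lemma continuous_measurable f : continuous f ->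
  measurable_fun [set: borel Z] (f : borel Z -> R).
Proof.
move=> cf; apply: (measurability _ (RGenOInfty.measurableE R)) => _ [_ [a ->] <-].
apply: measurableI => //; apply: sub_sigma_algebra.
by apply: open_comp => //; exact: interval_open.
Qed.

Lemma compact_continuous_bounded f : continuous f ->
  exists2 C : R, 0 < C & forall x, `|f x| <= C.
Proof.
move=> cf; have : compact (range f).
  by apply: continuous_compact => //; exact: continuous_subspaceT.
move=> /compact_bounded[M [_ hM]]; exists (`|M| + 1); first by rewrite ltr_wpDl.
by move=> x; apply: hM; [rewrite ltr_pwDr// ler_norm|exists x].
Qed.

Lemma continuous_integrable f mu : continuous f ->
  mu.-integrable [set: borel Z] (EFin \o (f : borel Z -> R)).
Proof.
move=> cf; apply: measurable_bounded_integrable => //.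
- exact: (le_lt_trans (probability_le1 mu measurableT) (ltry 1)).
- exact: continuous_measurable.
- have [C _ hC] := compact_continuous_bounded cf.
  by exists C; split; rewrite ?num_real// => M CM z _; exact: le_trans (hC z) (ltW CM).
Qed.

Lemma cintegralD f g mu : continuous f -> continuous g ->
  \int[mu]_x (f x + g x) = \int[mu]_x f x + \int[mu]_x g x.
Proof. by move=> cf cg; rewrite RintegralD//; exact: continuous_integrable. Qed.

Lemma cintegralB f g mu : continuous f -> continuous g ->
  \int[mu]_x (f x - g x) = \int[mu]_x f x - \int[mu]_x g x.
Proof. by move=> cf cg; rewrite RintegralB//; exact: continuous_integrable. Qed.

Lemma cintegralZ (r : R) f mu : continuous f ->
  \int[mu]_x (r * f x) = r * \int[mu]_x f x.
Proof. by move=> cf; rewrite RintegralZl//; exact: continuous_integrable. Qed.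

Lemma le_cintegral f g mu : continuous f -> continuous g ->
  (forall x, f x <= g x) -> \int[mu]_x f x <= \int[mu]_x g x.
Proof. by move=> cf cg fg; apply: le_Rintegral => //; exact: continuous_integrable. Qed.

Lemma continuous_sum (I : Type) (s : seq I) (P : pred I) (F : I -> Z -> R) :
  (forall i, P i -> continuous (F i)) -> continuous (fun x => \sum_(i <- s | P i) F i x).
Proof.
move=> cF; elim: s => [|i s ih].
  rewrite (_ : (fun _ => _) = cst 0); first by move=> x; exact: cvg_cst.
  by apply/funext => x; rewrite big_nil.
rewrite (_ : (fun _ => _) = if P i then (fun x => F i x + \sum_(i <- s | P i) F i x)
  else (fun x => \sum_(i <- s | P i) F i x)).
  case: ifPn => // Pi x.
  by apply: cvgD; [exact: cF|exact: ih].
by apply/funext => x; rewrite big_cons; case: ifP.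
Qed.

Lemma cintegral_sum (I : Type) (s : seq I) (F : I -> Z -> R) mu :
  (forall i, continuous (F i)) ->
  \int[mu]_x (\sum_(i <- s) F i x) = \sum_(i <- s) \int[mu]_x F i x.
Proof.
move=> cF; elim: s => [|i s ih].
  by under [LHS]eq_Rintegral do rewrite big_nil; rewrite Rintegral_probability_cst big_nil.
under [LHS]eq_Rintegral do rewrite big_cons.
by rewrite cintegralD ?ih ?big_cons//; exact: continuous_sum.
Qed.

Lemma norm_cintegral_le f mu (A : set (borel Z)) (e C eta : R) :
  continuous f -> measurable A -> (forall x, A x -> `|f x| <= e) ->
  (forall x, `|f x| <= C) -> 0 <= e -> 0 <= C -> (mu (~` A) <= eta%:E)%E ->
  `|\int[mu]_x f x| <= e + C * eta.
Proof.
by move=> cf *; apply: (norm_Rintegral_le (continuous_integrable mu cf)); eassumption.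
Qed.

Lemma norm_cintegral_bound f mu (e : R) : continuous f ->
  (forall z, `|f z| <= e) -> `|\int[mu]_x f x| <= e.
Proof.
move=> cf fe; have e0 : 0 <= e by exact: le_trans (fe point).
have := @norm_cintegral_le f mu setT e e 0; rewrite mulr0 addr0; apply=> //.
by rewrite setCT measure0.
Qed.

Lemma cintegral_dirac f (z : Z) : continuous f ->
  (\int[\d_(z : borel Z)]_x (f x)%:E = (f z)%:E)%E.
Proof.
move=> cf; rewrite integral_dirac ?diracT ?mul1e//.
by apply/measurable_EFinP; exact: continuous_measurable.
Qed.

Lemma ge0_cintegral_emp (T : Z -> Z) z n f : continuous f -> (forall x, 0 <= f x) ->
  \int[emp R T z 0 n]_x f x = n.+1%:R^-1 * \sum_(k < n.+1) f (iter k T z).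
Proof.
move=> cf f0; rewrite /Rintegral.
have mf : measurable_fun [set: borel Z] (fun x => (f x)%:E).
  by apply/measurable_EFinP; exact: continuous_measurable.
rewrite /emp ge0_integral_mscale//; last by move=> x _; rewrite lee_fin.
rewrite ge0_integral_measure_sum//; last by move=> x _; rewrite lee_fin.
rewrite subn0; under eq_bigr do rewrite cintegral_dirac//.
by rewrite sumEFin -EFinM.
Qed.

Lemma cintegral_emp (T : Z -> Z) z n f : continuous f ->
  \int[emp R T z 0 n]_x f x = n.+1%:R^-1 * \sum_(k < n.+1) f (iter k T z).
Proof.
move=> cf; have [C C0 hC] := compact_continuous_bounded cf.
(* Shifting by the bound [C] gives a nonnegative integrand; the shift cancels afterwards because
   [emp] has total mass 1. *)
have cfC : continuous (fun x => f x + C) by move=> x; apply: cvgD; [exact: cf|exact: cvg_cst].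
have := @ge0_cintegral_emp T z n _ cfC.
rewrite cintegralD ?Rintegral_probability_cst//; last by move=> x; exact: cvg_cst.
rewrite big_split/= mulrDr sumr_const card_ord -[C *+ n.+1]mulr_natl mulKf ?pnatr_eq0//.
move=> h; apply: (addIr C); apply: h => x.
by rewrite -lerBlDr sub0r; have := hC x; rewrite ler_norml => /andP[].
Qed.

End ContinuousIntegrals.

Lemma continuous_borel_measurable (Z Z' : ptopologicalType) (phi : Z -> Z') :
  continuous phi -> measurable_fun [set: borel Z] (phi : borel Z -> borel Z').
Proof.
move=> cphi; apply: (@measurability _ _ (borel Z) (borel Z') setT phi (@open Z')) => // _ [B oB <-].
by rewrite setTI; apply: sub_sigma_algebra; exact: open_comp.
Qed.

(** Change of variables under the pushforward by [phi]. With [phi] equal to [T] it yields invariance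
    of integrals, with a coordinate projection it yields the marginals. *)
Lemma cintegral_comp (R : realType) (Z Z' : ptopologicalType) (phi : Z -> Z')
  (mu : probability (borel Z) R) (mu' : probability (borel Z') R) (f : Z' -> R) :
  compact [set: Z] -> continuous phi -> continuous f ->
  (forall A : set (borel Z'), measurable A -> mu (phi @^-1` A) = mu' A) ->
  \int[mu]_x f (phi x) = \int[mu']_x f x.
Proof.
move=> cZ cphi cf hphi; rewrite /Rintegral; congr fine.
have mphi := continuous_borel_measurable cphi.
have cfphi : continuous (f \o phi) by move=> x; apply: continuous_comp; [exact: cphi|exact: cf].
pose psi : borel Z -> borel Z' := phi.
rewrite [RHS](@eq_measure_integral _ _ _ _ (pushforward mu psi)).
  rewrite integral_pushforward//.
  - by apply/measurable_EFinP; exact: continuous_measurable.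
  - exact: (continuous_integrable cZ _ cfphi).
by move=> A mA _ /=; exact/esym/hphi.
Qed.

(** * Partitions of unity and test functions *)

Section Heine.
Context (R : realType).

Lemma compact_uniformly_continuous (U : pseudoMetricType R) (f : U -> R) (e : R) :
  compact [set: U] -> continuous f -> 0 < e ->
  exists2 delta : R, 0 < delta & forall u v, ball u delta v -> `|f u - f v| < e.
Proof.
move=> /compact_near_coveringP cU cf e0.
(* Compactness in filter form: a bound valid near each point for all small radii holds at all points
   at once for all small radii. *)
have /(_ R (0^'+) (fun r u => forall v, ball u r v -> `|f u - f v| < e)) := cU.
case=> [u _|r /= r0 hr].
  have e2 : 0 < e / 2 by rewrite divr_gt0.
  have /cvgrPdist_lt/(_ _ e2) := cf u.
  rewrite -filter_from_ballE => -[r r0 hr]; exists (ball u (r / 2), [set s | 0 < s < r / 2]).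
    split=> /=; first by apply: nbhsx_ballx; rewrite divr_gt0.
    exists (r / 2); first by rewrite /= divr_gt0.
    move=> s /= sr s0; rewrite s0/=; move: sr; rewrite sub0r normrN ger0_norm// ltW//.
  move=> [v s]/= [uv /andP[s0 sr]] w vw.
  rewrite (splitr e) (le_lt_trans (ler_distD (f u) _ _))// ltrD//.
    rewrite distrC; apply: hr; apply: le_ball uv.
    by rewrite ler_pdivrMr// ler_pMr// ler1n.
  apply: hr; rewrite (splitr r); apply: ball_triangle uv _.
  by apply: le_ball vw; exact: ltW.
exists (r / 2); first by rewrite divr_gt0.
move=> u v uv; apply: (hr (r / 2)) => //=; last by rewrite divr_gt0.
by rewrite sub0r normrN ger0_norm ?divr_ge0 ?ltW// ltr_pdivrMr// ltr_pMr// ltr1n.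
Qed.

End Heine.

Section PartitionsOfUnity.
Context (R : realType).

(** The points [pou_center] carry no condition here; their closeness to the supports of the bumps is
    a separate property, supplied by [metric_pou]. *)
Record pou (Z : ptopologicalType) := Pou {
  pou_index : finType;
  pou_center : pou_index -> Z;
  pou_bump : pou_index -> Z -> R;
  pou_bump_continuous : forall i, continuous (pou_bump i);
  pou_bump_ge0 : forall i z, 0 <= pou_bump i z;
  pou_bump_sum : forall z, \sum_i pou_bump i z = 1 }.

(** A convex combination of numbers within [e] of [r] stays within [e] of [r]; an index whose bump
    vanishes at [z] has weight zero. *)
Lemma pou_average (Z : ptopologicalType) (p : pou Z) (z : Z) (a : pou_index p -> R)
    (r e : R) :
  (forall i, 0 < pou_bump i z -> `|a i - r| <= e) ->
  `|\sum_i a i * pou_bump i z - r| <= e.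
Proof.
move=> h; have -> : \sum_i a i * pou_bump i z - r = \sum_i (a i - r) * pou_bump i z.
  under [RHS]eq_bigr do rewrite mulrBl.
  by rewrite sumrB -mulr_sumr pou_bump_sum mulr1.
rewrite (le_trans (ler_norm_sum _ _ _))// -[e]mulr1 -(pou_bump_sum p z) mulr_sumr.
apply: ler_sum => i _; rewrite normrM (ger0_norm (pou_bump_ge0 i z)).
have := pou_bump_ge0 i z; rewrite le_eqVlt => /orP[/eqP <-|b0]; first by rewrite !mulr0.
by rewrite ler_pM2r// h.
Qed.

Definition pou_prod (Z W : ptopologicalType) (p : pou Z) (q : pou W) :
  pou (Z * W)%type.
Proof.
apply: (@Pou _ (pou_index p * pou_index q)%type
  (fun ij => (pou_center ij.1, pou_center ij.2))
  (fun ij zw => pou_bump ij.1 zw.1 * pou_bump ij.2 zw.2)).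
- move=> ij zw; apply: cvgM.
    by apply: continuous_comp; [exact: cvg_fst|exact: pou_bump_continuous].
  by apply: continuous_comp; [exact: cvg_snd|exact: pou_bump_continuous].
- by move=> ij zw; rewrite mulr_ge0// pou_bump_ge0.
- move=> zw; rewrite -(pair_bigA _ (fun i j => pou_bump i zw.1 * pou_bump j zw.2))/=.
  by under eq_bigr do rewrite -mulr_sumr pou_bump_sum mulr1; rewrite pou_bump_sum.
Defined.

Lemma continuous_mdist (X : pmetricType R) (c : X) : continuous (mdist c : X -> R).
Proof.
move=> x; apply/cvgrPdist_lt => e e0; apply/nbhs_ballP.
exists e => // y /=; rewrite ballEmdist /= => xy.
have h1 := metric_triangle c x y; have h2 := metric_triangle c y x.
rewrite (metric_sym y x) in h2.
by rewrite ltr_norml; apply/andP; split; lra.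
Qed.

Lemma compact_finite_net (X : pmetricType R) (delta : R) :
  compact [set: X] -> 0 < delta ->
  exists s : seq X, forall x, exists2 c, c \in s & mdist c x < delta.
Proof.
rewrite compact_cover => cX d0.
have /(_ X setT (fun c => [set x | mdist c x < delta])) [] := cX.
- move=> c _; rewrite -[X in open X]/((mdist c : X -> R) @^-1` [set r | r < delta]).
  by apply: open_comp; [move=> x _; exact: continuous_mdist|exact: open_lt].
- by move=> x _; exists x => //=; rewrite mdistxx.
move=> D _ hD; exists (finmap.enum_fset D) => x.
by have [c /= cD cx] := hD x I; exists c.
Qed.

Lemma metric_pou (X : pmetricType R) (delta : R) :
  compact [set: X] -> 0 < delta ->
  exists p : pou X, forall (i : pou_index p) x, 0 < pou_bump i x ->
    mdist (pou_center i) x < delta.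
Proof.
move=> cX d0; have [s hs] := compact_finite_net cX d0.
pose c (i : 'I_(size s)) : X := nth point s i.
(* Tent functions around the points of a finite [delta]-net. Their sum is positive everywhere by the
   net property, so it can be divided out. *)
pose b i x : R := Num.max 0 (delta - mdist (c i) x).
have b0 i x : 0 <= b i x by rewrite le_max lexx.
have cb i : continuous (b i).
  move=> x; apply: (@continuous_max R X (cst 0)); first exact: cvg_cst.
  by apply: cvgB; [exact: cvg_cst|exact: continuous_mdist].
pose B x := \sum_i b i x.
have cB : continuous B by exact: continuous_sum.
have Bpos x : 0 < B x.
  have [y ys yx] := hs x.
  have ylt : (index y s < size s)%N by rewrite index_mem.
  rewrite /B (bigD1 (Ordinal ylt))//= ltr_pwDl//; last exact: sumr_ge0.
  by rewrite /b lt_max /c/= nth_index// subr_gt0 yx orbT.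
have hc i : continuous (fun x => b i x / B x).
  by move=> x; apply: cvgM; [exact: cb|apply: cvgV; [rewrite gt_eqF|exact: cB]].
have h0 i x : 0 <= b i x / B x by rewrite divr_ge0// ltW.
have h1 x : \sum_i b i x / B x = 1 by rewrite -mulr_suml -/(B x) divff// gt_eqF.
pose p : pou X := @Pou X _ c (fun i x => b i x / B x) hc h0 h1.
exists p => i x /=.
by rewrite pmulr_lgt0 ?invr_gt0// /b lt_max ltxx/= subr_gt0.
Qed.

(** The linear span of a countable family is uniformly dense. Weak* convergence can then be tested
    on countably many functions, which the diagonal construction treats finitely many at a time. *)
Definition dense_span (Z : ptopologicalType) (h : nat -> Z -> R) :=
  forall f : Z -> R, continuous f -> forall e : R, 0 < e ->
    exists s : seq (R * nat), forall z, `|f z - \sum_(p <- s) p.1 * h p.2 z| <= e.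

(** The family enumerates all bumps of all the partitions, with the zero function at codes that
    decode to nothing. The approximation of [f] has coefficients [f (pou_center i)]. *)
Lemma pou_dense_span (Z : ptopologicalType) (p_ : nat -> pou Z) :
  (forall f : Z -> R, continuous f -> forall e : R, 0 < e ->
    exists k, forall (i : pou_index (p_ k)) z, 0 < pou_bump i z ->
      `|f (pou_center i) - f z| <= e) ->
  exists2 h : nat -> Z -> R, forall n, continuous (h n) & dense_span h.
Proof.
move=> hp; pose I := {k : nat & pou_index (p_ k)}.
pose h n : Z -> R := if unpickle n is Some ki then pou_bump (projT2 (ki : I)) else cst 0.
exists h.
  move=> n; rewrite /h; case: unpickle => [ki|]; first exact: pou_bump_continuous.
  by move=> x; exact: cvg_cst.
move=> f cf e e0; have [k hk] := hp f cf e e0.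
exists [seq (f (pou_center i), pickle (Tagged (fun k => pou_index (p_ k)) i : I))
  | i <- index_enum (pou_index (p_ k))] => z.
rewrite big_map/= distrC.
under eq_bigr do rewrite /h pickleK/=.
by apply: pou_average => i; exact: hk.
Qed.

Lemma dense_span_metric (X : pmetricType R) : compact [set: X] ->
  exists2 h : nat -> X -> R, forall n, continuous (h n) & dense_span h.
Proof.
move=> cX.
have d0 k : 0 < k.+1%:R^-1 :> R by rewrite invr_gt0.
have /choice[p_ hp] k := metric_pou cX (d0 k).
apply: (pou_dense_span (p_ := p_)) => f cf e e0.
have [delta delta0 hd] := compact_uniformly_continuous cX cf e0.
have [k kd] : exists k : nat, k.+1%:R^-1 < delta.
  exists (Num.truncn delta^-1); rewrite invf_plt ?posrE//.
  by rewrite truncnS_gt.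
exists k => i x ix; apply/ltW/hd; rewrite ballEmdist/=.
exact: lt_trans (hp k i x ix) kd.
Qed.

Lemma dense_span_prod (X Y : pmetricType R) :
  compact [set: X] -> compact [set: Y] ->
  exists2 h : nat -> X * Y -> R, forall n, continuous (h n) & dense_span h.
Proof.
move=> cX cY; have cXY : compact [set: X * Y] by rewrite -setXTT; exact: compact_setX.
have d0 k : 0 < k.+1%:R^-1 :> R by rewrite invr_gt0.
have /choice[p_ hp] k := metric_pou cX (d0 k).
have /choice[q_ hq] k := metric_pou cY (d0 k).
apply: (pou_dense_span (p_ := fun k => pou_prod (p_ k) (q_ k))) => f cf e e0.
have [delta delta0 hd] := compact_uniformly_continuous cXY cf e0.
have [k kd] : exists k : nat, k.+1%:R^-1 < delta.
  exists (Num.truncn delta^-1); rewrite invf_plt ?posrE//.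
  by rewrite truncnS_gt.
exists k => -[i j] [x y] /= ij; apply/ltW/hd.
have i0 : 0 < pou_bump i x.
  rewrite lt_neqAle pou_bump_ge0 andbT; apply: contraTneq ij => <-.
  by rewrite mul0r ltxx.
have j0 : 0 < pou_bump j y by move: ij; rewrite pmulr_rgt0.
split; rewrite /= ballEmdist/=; first exact: lt_trans (hp k i x i0) kd.
exact: lt_trans (hq k j y j0) kd.
Qed.

Lemma weak_star_cvg_dense (Z : ptopologicalType) (h : nat -> Z -> R)
    (mu_ : (probability (borel Z) R)^nat) (mu : probability (borel Z) R) :
  compact [set: Z] -> (forall n, continuous (h n)) -> dense_span h ->
  (forall i, (fun n => \int[mu_ n]_x h i x) @ \oo --> \int[mu]_x h i x) ->
  weak_star_cvg mu_ mu.
Proof.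
move=> cZ ch dh hmu f cf; apply/cvgrPdist_le => e e0.
have e3 : 0 < e / 3 by rewrite divr_gt0.
have [s hs] := dh f cf _ e3.
pose g z := \sum_(p <- s) p.1 * h p.2 z.
have cg1 (p : R * nat) : continuous (fun z => p.1 * h p.2 z).
  by move=> z; apply: cvgM; [exact: cvg_cst|exact: ch].
have cg : continuous g by apply: continuous_sum => p _; exact: cg1.
have intg (P : probability (borel Z) R) :
    \int[P]_x g x = \sum_(p <- s) p.1 * \int[P]_x h p.2 x.
  by rewrite cintegral_sum//; apply: eq_bigr => p _; rewrite cintegralZ.
have close (P : probability (borel Z) R) : `|\int[P]_x f x - \int[P]_x g x| <= e / 3.
  rewrite -cintegralB//.
  apply: (@norm_cintegral_bound R Z cZ (fun x => f x - g x) P) => // x.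
  by apply: cvgB; [exact: cf|exact: cg].
have : (fun n => \int[mu_ n]_x g x) @ \oo --> \int[mu]_x g x.
  under eq_fun do rewrite intg; rewrite intg.
  apply: (@cvg_big _ _ +%R 0) => // [|p _]; first by move=> x; exact: add_continuous.
  by apply: cvgM; [exact: cvg_cst|exact: hmu].
move=> /cvgrPdist_le/(_ _ e3); apply: filterS => n hn.
have h1 := close mu; have h2 := close (mu_ n); rewrite distrC in h2.
by move: h1 h2 hn; rewrite !ler_norml => /andP[? ?] /andP[? ?] /andP[? ?]; lra.
Qed.

End PartitionsOfUnity.

(** * Ergodic averages *)

Lemma probability_exhaustion d (T : measurableType d) (R : realType)
    (P : probability T R) (A : nat -> set T) (eta : R) :
  (forall n, measurable (A n)) -> nondecreasing_seq A ->
  P (\bigcup_n A n) = 1%E -> 0 < eta -> exists n, (P (~` A n) <= eta%:E)%E.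
Proof.
move=> mA ndA PA eta0.
have mU : measurable (\bigcup_n A n) by exact: bigcup_measurable.
have : P \o A @ \oo --> P (\bigcup_n A n) by exact: nondecreasing_cvg_mu.
rewrite PA => /fine_cvgP[_ /cvgrPdist_le/(_ _ eta0)[n _ /(_ n (leqnn n)) /=]].
rewrite ler_norml => /andP[_ hn]; exists n; rewrite probability_setC//.
rewrite -[P (A n)]fineK ?fin_num_measure// -EFinB lee_fin.
Qed.

(** * The maximal ergodic theorem and its consequence for Birkhoff sums *)

Section Garsia.
Context (R : realType) (Z : ptopologicalType) (T : Z -> Z) (g : Z -> R).
Hypotheses (cT : continuous T) (cg : continuous g).

(* The maximum of 0 and of the Birkhoff sums of g of length at most N. *)
Fixpoint max_birkhoff (N : nat) (z : Z) : R :=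
  if N is N'.+1 then Num.max 0 (g z + max_birkhoff N' (T z)) else 0.

Lemma continuous_max_birkhoff N : continuous (max_birkhoff N).
Proof.
elim: N => [|N ih] z; first exact: cvg_cst.
apply: (@continuous_max R Z (cst 0) (fun z => g z + max_birkhoff N (T z))); first exact: cvg_cst.
apply: cvgD; first exact: cg.
by apply: continuous_comp; [exact: cT|exact: ih].
Qed.

Lemma max_birkhoff_ge0 N z : 0 <= max_birkhoff N z.
Proof. by case: N => [|N]//=; rewrite le_max lexx. Qed.

Lemma max_birkhoffS N z : max_birkhoff N z <= max_birkhoff N.+1 z.
Proof.
elim: N z => [|N ih] z; first exact: max_birkhoff_ge0.
by rewrite /= ge_max le_max lexx/= le_max lerD2l -/(max_birkhoff N.+1 (T z)) ih orbT.
Qed.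

Lemma le_max_birkhoff m n z : (m <= n)%N -> max_birkhoff m z <= max_birkhoff n z.
Proof.
move=> mn; apply: (@homo_leq _ (fun n => max_birkhoff n z) (fun x y => x <= y)) mn.
- by [].
- exact: le_trans.
- by move=> i; exact: max_birkhoffS.
Qed.

Lemma birkhoff_sum_le n z : \sum_(k < n) g (iter k T z) <= max_birkhoff n z.
Proof.
elim: n z => [|n ih] z; first by rewrite big_ord0.
rewrite big_ord_recl/= le_max; apply/orP; right; rewrite lerD2l.
by rewrite (le_trans _ (ih (T z)))//; apply: ler_sum => k _; rewrite -iterSr.
Qed.

Definition unbounded_birkhoff : set (borel Z) :=
  \bigcap_K \bigcup_N [set z : borel Z | K%:R < max_birkhoff N z].

Lemma measurable_max_birkhoff_gt (r : R) N :
  measurable [set z : borel Z | r < max_birkhoff N z].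
Proof.
apply: sub_sigma_algebra.
rewrite -[X in open X]/((max_birkhoff N) @^-1` [set s | r < s]).
by apply: open_comp; [move=> z _; exact: continuous_max_birkhoff|exact: open_gt].
Qed.

Lemma measurable_unbounded_birkhoff : measurable unbounded_birkhoff.
Proof.
apply: bigcapT_measurable => K; apply: bigcupT_measurable => N.
exact: measurable_max_birkhoff_gt.
Qed.

(** Passing between [z] and [T z] changes Birkhoff sums by one value of [g], at most [C] in absolute
    value; asking for the level [K] plus a margin above [C] absorbs it. The equality is exact, as
    the definition of [ergodic] demands. *)
Lemma unbounded_birkhoff_invariant (C : R) : (forall z, `|g z| <= C) ->
  T @^-1` unbounded_birkhoff = unbounded_birkhoff.
Proof.
move=> hC; apply/seteqP; split=> z h K _.
  have [N _ /= hN] := h (K + (Num.truncn C).+1)%N I; exists N.+1 => //=.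
  rewrite lt_max; apply/orP; right.
  have /ler_normlP[h1 _] := hC z; have h2 := truncnS_gt C.
  by rewrite natrD in hN; lra.
have [[|N] _ /=] := h (K + (Num.truncn C).+1)%N I; first by rewrite ltNge ler0n.
rewrite lt_max ltNge ler0n/= => hN; exists N => //=.
have /ler_normlP[_ h1] := hC z; have h2 := truncnS_gt C.
by rewrite natrD in hN; lra.
Qed.

Hypothesis cZ : compact [set: Z].
Variable mu : probability (borel Z) R.
Hypothesis imu : invariant_measure T mu.

Lemma cintegral_invariant (f : Z -> R) : continuous f ->
  \int[mu]_x f (T x) = \int[mu]_x f x.
Proof. by move=> cf; exact: cintegral_comp. Qed.

(* Garsia: where [max_birkhoff N.+1] is positive it equals [g + max_birkhoff N \o T],
   and by invariance [T] may be dropped from the integral. *)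
Lemma maximal_ergodic : mu unbounded_birkhoff = 1%E -> 0 <= \int[mu]_x g x.
Proof.
move=> muE; have [C C0 hC] := compact_continuous_bounded cZ cg.
pose A N := [set z : borel Z | 0 < max_birkhoff N z].
have mA N : measurable (A N) by exact: measurable_max_birkhoff_gt.
have ndA : nondecreasing_seq A.
  move=> m n mn; apply/subsetPset => z /= h.
  exact: lt_le_trans h (le_max_birkhoff _ mn).
have muA : mu (\bigcup_N A N) = 1%E.
  apply/eqP; rewrite eq_le probability_le1; last exact: bigcup_measurable.
  rewrite -muE le_measure ?inE//; [exact: measurable_unbounded_birkhoff|exact: bigcup_measurable|].
  by move=> z /(_ 0%N I).
rewrite -[X in _ <= X]opprK oppr_ge0; apply/ler_addgt0Pr => e e0; rewrite add0r.
have eC : 0 < e / C by rewrite divr_gt0.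
have [N hN] := probability_exhaustion mA ndA muA eC.
have {}hN : (mu (~` A N.+1) <= (e / C)%:E)%E.
  apply: (le_trans _ hN); apply: le_measure; rewrite ?inE; [exact: measurableC|exact: measurableC|].
  by apply: subsetC; have /subsetPset := ndA _ _ (leqnSn N).
(* [u] is the defect in the recursion for [max_birkhoff]: zero on [A N.+1] and at most [C]
   elsewhere, so its integral is at most [e]. Since [max_birkhoff] increases with [N], that integral
   is also at least minus the integral of [g]. *)
pose u z := max_birkhoff N.+1 z - g z - max_birkhoff N (T z).
have cMT : continuous (fun z => max_birkhoff N (T z)).
  by move=> z; apply: continuous_comp; [exact: cT|exact: continuous_max_birkhoff].
have cMg : continuous (fun z => max_birkhoff N.+1 z - g z).
  by move=> z; apply: cvgB; [exact: (@continuous_max_birkhoff N.+1)|exact: cg].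
have cu : continuous u by move=> z; apply: cvgB; [exact: cMg|exact: cMT].
have intu : \int[mu]_x u x =
    \int[mu]_x max_birkhoff N.+1 x - \int[mu]_x g x - \int[mu]_x max_birkhoff N x.
  rewrite cintegralB// cintegralB//; last exact: (@continuous_max_birkhoff N.+1).
  by rewrite cintegral_invariant//; exact: continuous_max_birkhoff.
have : `|\int[mu]_x u x| <= 0 + C * (e / C).
  apply: (@norm_cintegral_le R Z cZ u mu (A N.+1)) => //; last by exact: ltW.
    move=> z; rewrite /A/= lt_max ltxx/= => h.
    suff -> : u z = 0 by rewrite normr0.
    by rewrite /u/= (max_r (ltW h)); ring.
  move=> z; have /ler_normlP[h1 h2] := hC z.
  have h3 := max_birkhoff_ge0 N (T z).
  have [h|h] := leP 0 (g z + max_birkhoff N (T z)).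
    suff -> : u z = 0 by rewrite normr0 ltW.
    by rewrite /u/= (max_r h); ring.
  rewrite /u/= (max_l (ltW h)).
  by rewrite ler_norml; apply/andP; split; lra.
have : \int[mu]_x max_birkhoff N x <= \int[mu]_x max_birkhoff N.+1 x.
  by apply: le_cintegral => //; [exact: continuous_max_birkhoff|exact: (@continuous_max_birkhoff N.+1)|exact: max_birkhoffS].
rewrite intu add0r mulrC divfK ?gt_eqF// => h /ler_normlP[_].
lra.
Qed.

(** Ergodicity makes [unbounded_birkhoff] null or of full measure, and the maximal inequality
    excludes the latter since the integral is negative. The maximal sums are thus almost surely
    bounded, so one [K] serves all lengths [m]. *)
Lemma birkhoff_sum_bounded (eta : R) : ergodic T mu -> \int[mu]_x g x < 0 -> 0 < eta ->
  exists K : nat, forall m, (mu [set z : borel Z | (K%:R < \sum_(k < m) g (iter k T z))%R] <= eta%:E)%E.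
Proof.
move=> [_ erg] g0 eta0; have [C C0 hC] := compact_continuous_bounded cZ cg.
have mE := measurable_unbounded_birkhoff.
have [muE|muE] := erg _ mE (unbounded_birkhoff_invariant hC); last first.
  by have := maximal_ergodic muE; rewrite leNgt g0.
pose U K := \bigcup_N [set z : borel Z | K%:R < max_birkhoff N z].
have mU K : measurable (U K).
  by apply: bigcupT_measurable => N; exact: measurable_max_birkhoff_gt.
have mA K : measurable (~` U K) by exact: measurableC.
have ndA : nondecreasing_seq (fun K => ~` U K).
  move=> m n mn; apply/subsetPset; apply: subsetC => z [N _ /= hN]; exists N => //=.
  by apply: le_lt_trans hN; rewrite ler_nat.
have muA : mu (\bigcup_K ~` U K) = 1%E.
  rewrite -setC_bigcap probability_setC//.
  by rewrite [X in (1 - X)%E](_ : _ = 0%E) ?sube0.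
have [K hK] := probability_exhaustion mA ndA muA eta0; exists K => m.
rewrite setCK in hK; apply: le_trans hK; apply: le_measure; rewrite ?inE//.
  apply: sub_sigma_algebra.
  rewrite -[X in open X]/((fun z => \sum_(k < m) g (iter k T z)) @^-1` [set s | K%:R < s]).
  apply: open_comp; last exact: open_gt.
  move=> z _; apply: continuous_sum => k _ {}z.
  apply: continuous_comp; last exact: cg.
  elim: (nat_of_ord k) => [|n ih] /=; first exact: cvg_id.
  by apply: continuous_comp; [exact: ih|exact: cT].
by move=> z /= hz; exists m => //=; exact: lt_le_trans hz (birkhoff_sum_le _ _).
Qed.

End Garsia.

(** * Finitely many ergodic averages, uniformly off a small set *)

Section ErgodicAverages.
Context (R : realType) (Z : ptopologicalType) (T : Z -> Z).
Hypotheses (cT : continuous T) (cZ : compact [set: Z]).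
Variable mu : probability (borel Z) R.
Hypothesis emu : ergodic T mu.

Lemma continuous_iter k : continuous (iter k T).
Proof.
elim: k => [|k ih] z /=; first exact: cvg_id.
by apply: continuous_comp; [exact: ih|exact: cT].
Qed.

Lemma ergodic_average_le (f : Z -> R) (e eta : R) : continuous f ->
  0 < e -> 0 < eta -> exists m0, forall m, (m0 <= m)%N ->
  (mu [set z : borel Z | (e * m%:R < \sum_(k < m) (f (iter k T z) - \int[mu]_x f x))%R] <= eta%:E)%E.
Proof.
move=> cf e0 eta0.
(* The extra [e / 2] makes the integral of [g] negative. A deviation above [e * m] then forces the
   sum of [g] above [m * (e / 2)], which exceeds [K] once [m] is large. *)
pose g z := f z - (\int[mu]_x f x + e / 2).
have cg : continuous g by move=> z; apply: cvgB; [exact: cf|exact: cvg_cst].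
have g0 : \int[mu]_x g x < 0.
  rewrite cintegralB//; last by move=> z; exact: cvg_cst.
  by rewrite Rintegral_probability_cst; lra.
have [K hK] := birkhoff_sum_bounded cT cg cZ emu.1 emu g0 eta0.
exists (Num.truncn (K%:R / (e / 2))).+1 => m hm.
apply: le_trans (hK m); apply: le_measure; rewrite ?inE.
- apply: sub_sigma_algebra.
  rewrite -[X in open X]/((fun z => \sum_(k < m) (f (iter k T z) - \int[mu]_x f x)) @^-1` [set s | e * m%:R < s]).
  apply: open_comp; last exact: open_gt.
  move=> z _; apply: continuous_sum => k _ {}z.
  apply: cvgB; last exact: cvg_cst.
  by apply: continuous_comp; [exact: continuous_iter|exact: cf].
- apply: sub_sigma_algebra.
  rewrite -[X in open X]/((fun z => \sum_(k < m) g (iter k T z)) @^-1` [set s | K%:R < s]).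
  apply: open_comp; last exact: open_gt.
  move=> z _; apply: continuous_sum => k _ {}z.
  by apply: continuous_comp; [exact: continuous_iter|exact: cg].
move=> z /= hz.
have -> : \sum_(k < m) g (iter k T z) =
    \sum_(k < m) (f (iter k T z) - \int[mu]_x f x) - m%:R * (e / 2).
  rewrite mulr_natl -[X in _ *+ X]card_ord -sumr_const -sumrB.
  by apply: eq_bigr => k _; rewrite /g; ring.
have : K%:R / (e / 2) < m%:R by rewrite (lt_le_trans (truncnS_gt _))// ler_nat.
rewrite ltr_pdivrMr ?divr_gt0// => h.
lra.
Qed.

Definition good_averages (f : nat -> Z -> R) (d : nat) (e : R) (m : nat) : set (borel Z) :=
  [set z | forall i, (i < d)%N ->
    `|\sum_(k < m) (f i (iter k T z) - \int[mu]_x f i x)| <= e * m%:R].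

(** Induction on the number of functions: the earlier ones receive mass [eta / 2], and the two
    one-sided deviations of the new one, via [f d] and its negative, receive [eta / 4] each. *)
Lemma ergodic_averages (f : nat -> Z -> R) (d : nat) (e eta : R) :
  (forall i, continuous (f i)) -> 0 < e -> 0 < eta ->
  exists m0, forall m, (m0 <= m)%N ->
    measurable (good_averages f d e m) /\ (mu (~` good_averages f d e m) <= eta%:E)%E.
Proof.
move=> cf e0; elim: d eta => [|d ih] eta eta0.
  exists 0%N => m _; have -> : good_averages f 0 e m = setT by apply/seteqP; split.
  by split=> //; rewrite setCT measure0 lee_fin ltW.
have eta2 : 0 < eta / 2 by rewrite divr_gt0.
have eta4 : 0 < eta / 4 by rewrite divr_gt0.
have cNf : continuous (fun z => - f d z) by move=> z; apply: cvgN; exact: cf.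
have [m0 h0] := ih _ eta2.
have [m1 h1] := ergodic_average_le (cf d) e0 eta4.
have [m2 h2] := ergodic_average_le cNf e0 eta4.
exists (maxn m0 (maxn m1 m2)) => m; rewrite !geq_max => /and3P[/h0[mG muG] /h1 mu1 /h2 mu2].
pose S (i : nat) z := \sum_(k < m) (f i (iter k T z) - \int[mu]_x f i x).
have cS i : continuous (S i).
  apply: continuous_sum => k _ z; apply: cvgB; last exact: cvg_cst.
  by apply: continuous_comp; [exact: continuous_iter|exact: cf].
have mS1 : measurable [set z : borel Z | e * m%:R < S d z].
  apply: sub_sigma_algebra.
  rewrite -[X in open X]/(S d @^-1` [set s | e * m%:R < s]).
  by apply: open_comp; [move=> z _; exact: cS|exact: open_gt].
have mS2 : measurable [set z : borel Z | S d z < - (e * m%:R)].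
  apply: sub_sigma_algebra.
  rewrite -[X in open X]/(S d @^-1` [set s | s < - (e * m%:R)]).
  by apply: open_comp; [move=> z _; exact: cS|exact: open_lt].
have dec : ~` good_averages f d.+1 e m = ~` good_averages f d e m `|`
    ([set z : borel Z | e * m%:R < S d z] `|` [set z : borel Z | S d z < - (e * m%:R)]).
  apply/seteqP; split=> z.
    apply: contra_notP => /not_orP[/contrapT h /not_orP[/= /negP]].
    rewrite -leNgt => h3 /negP; rewrite -leNgt => h4 i; rewrite ltnS leq_eqVlt => /orP[/eqP ->|].
      by rewrite ler_norml h3 h4.
    exact: h.
  move=> h hz; case: h => [|[|]].
  - by apply => i id; apply: hz; rewrite ltnS ltnW.
  - rewrite /= ltNge => /negP; apply.
    by have /ler_normlP[] := hz d (ltnSn d).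
  - rewrite /= ltNge => /negP; apply.
    by have := hz d (ltnSn d); rewrite ler_norml => /andP[].
split.
  by rewrite -[good_averages _ _ _ _]setCK dec; apply: measurableC; apply: measurableU;
    [exact: measurableC|exact: measurableU].
rewrite dec.
apply: (le_trans (measureU2 _ _ _)) => //; [exact: measurableC|exact: measurableU|].
have -> : eta = eta / 2 + (eta / 4 + eta / 4) by lra.
rewrite EFinD; apply: leeD => //.
apply: (le_trans (measureU2 _ _ _)) => //.
rewrite EFinD; apply: leeD => //.
have intN : \int[mu]_x (- f d x) = - \int[mu]_x f d x.
  under eq_Rintegral do rewrite -mulN1r.
  by rewrite cintegralZ// mulN1r.
apply: le_trans mu2; apply: le_measure; rewrite ?inE//.
  rewrite (_ : [set _ | _] = [set z : borel Z | S d z < - (e * m%:R)])//.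
  apply/seteqP; split=> z /=; rewrite intN /S.
    under eq_bigr do rewrite -opprD; rewrite sumrN; lra.
  under [X in _ -> _ < X]eq_bigr do rewrite -opprD; rewrite sumrN; lra.
move=> z /=; rewrite intN /S => h.
by under eq_bigr do rewrite -opprD; rewrite sumrN; lra.
Qed.

End ErgodicAverages.

(** * Approximate conditional laws *)

Section Kernel.
Context (R : realType) (X Y : pmetricType R).
Hypotheses (cX : compact [set: X]) (cY : compact [set: Y]).
Variables (xi : probability (borel (X * Y)%type) R).
Variables (mu : probability (borel X) R) (nu : probability (borel Y) R).
Hypothesis marg : marginals xi mu nu.

Let cXY : compact [set: X * Y].
Proof. by rewrite -setXTT; exact: compact_setX. Qed.

Lemma uniform_modulus (F : nat -> X * Y -> R) (d : nat) (e : R) :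
  (forall k, continuous (F k)) -> 0 < e ->
  exists2 delta : R, 0 < delta & forall k, (k < d)%N -> forall x x' y y',
    mdist x x' < delta -> mdist y y' < delta -> `|F k (x, y) - F k (x', y')| < e.
Proof.
move=> cF e0; elim: d => [|d [delta delta0 hd]]; first by exists 1.
have [delta' delta'0 hd'] := compact_uniformly_continuous cXY (cF d) e0.
exists (Num.min delta delta'); first by rewrite lt_min delta0.
move=> k; rewrite ltnS leq_eqVlt => /orP[/eqP ->|kd] x x' y y'; rewrite !lt_min.
  move=> /andP[_ xx'] /andP[_ yy']; apply: hd'; split; rewrite /= ballEmdist//=.
by move=> /andP[xx' _] /andP[yy' _]; exact: hd.
Qed.

(** [P i y] approximates the conditional probability, given second coordinate [y], that the first
    coordinate lies near the [i]-th center; [w i] represents that cell by a point of the good set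
    [G]. Smoothing by bumps makes [P i] continuous, so that it can be averaged along a quasi-generic
    orbit. *)
Lemma conditional_kernel (F : nat -> X * Y -> R) (d : nat) (e C eta : R) (G : set (borel X)) :
  (forall k, continuous (F k)) -> (forall k z, (k < d)%N -> `|F k z| <= C) -> 0 <= C ->
  0 < e -> 2 * C * eta <= e -> eta < 1 -> measurable G -> (mu (~` G) <= eta%:E)%E ->
  exists (I : finType) (w : I -> X) (P : I -> Y -> R),
    [/\ forall i, G (w i), forall i, continuous (P i), forall i y, 0 <= P i y,
        forall y, \sum_i P i y = 1 &
        forall k, (k < d)%N ->
          `|\int[nu]_y (\sum_i P i y * F k (w i, y)) - \int[xi]_z F k z| <= 3 * e].
Proof.
move=> cF FC C0 e0 Ceta eta1 mG muG.
have [delta delta0 hdelta] := uniform_modulus d cF e0.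
(* Half of [delta], since a point and its representative [w i] will be compared through the center
   of their common bump. *)
have d2 : 0 < delta / 2 by rewrite divr_gt0.
have [p hp] := metric_pou cX d2.
have [q hq] := metric_pou cY delta0.
have [x0 Gx0] : exists x, G x.
  apply: contrapT => /forallNP nG; have G0 : G = set0 by apply/seteqP; split=> x // /nG.
  by move: muG; rewrite G0 setC0 (probability_setT mu) lee_fin leNgt eta1.
pose I := pou_index p; pose J := pou_index q.
have [i0 _] : exists i : I, True.
  apply: contrapT => /forallNP nI; have := pou_bump_sum p point.
  by rewrite big1 => [/esym/eqP|i]; rewrite ?oner_eq0//; have := nI i.
(* The representative lies in the support of bump [i] whenever that support meets [G]; otherwise the
   default [x0] is used, and no pair with first coordinate in [G] sees it. *)
have /choice[w hw] (i : I) : exists x : X, G x /\ ((exists2 x' : X, G x' & 0 < pou_bump i x') -> 0 < pou_bump i x).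
  have [[x' Gx' ix']|nx] := pselect (exists2 x' : X, G x' & 0 < pou_bump i x'); first by exists x'.
  by exists x0; split.
have cfst : continuous (@fst X Y) by move=> z; exact: cvg_fst.
have csnd : continuous (@snd X Y) by move=> z; exact: cvg_snd.
have cbX (i : I) : continuous (fun z : X * Y => pou_bump i z.1).
  by move=> z; apply: continuous_comp; [exact: cfst|exact: pou_bump_continuous].
have cbY (j : J) : continuous (fun z : X * Y => pou_bump j z.2).
  by move=> z; apply: continuous_comp; [exact: csnd|exact: pou_bump_continuous].
have cbXY (i : I) (j : J) : continuous (fun z : X * Y => pou_bump i z.1 * pou_bump j z.2).
  by move=> z; apply: cvgM; [exact: cbX|exact: cbY].
pose m i j := \int[xi]_z (pou_bump (i : I) z.1 * pou_bump (j : J) z.2).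
pose v j := \int[nu]_y pou_bump (j : J) y.
have m0 i j : 0 <= m i j.
  by apply: Rintegral_ge0 => z _; rewrite mulr_ge0// pou_bump_ge0.
have v0 j : 0 <= v j by apply: Rintegral_ge0 => z _; exact: pou_bump_ge0.
have sm j : \sum_i m i j = v j.
  rewrite -cintegral_sum//.
  under eq_Rintegral do rewrite -mulr_suml pou_bump_sum mul1r.
  exact: (@cintegral_comp R _ _ snd xi nu (pou_bump j) cXY csnd (@pou_bump_continuous _ _ q j) marg.2).
pose Q i j : R := if v j == 0 then (i == i0)%:R else m i j / v j.
have Q0 i j : 0 <= Q i j by rewrite /Q; case: ifP => _; rewrite ?ler0n// divr_ge0.
have sQ j : \sum_i Q i j = 1.
  have [vj|vj] := eqVneq (v j) 0.
    by rewrite /Q vj eqxx (bigD1 i0)//= eqxx big1 ?addr0// => i /negbTE ->.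
  rewrite /Q (negbTE vj); have -> : \sum_i m i j / v j = (\sum_i m i j) / v j by rewrite mulr_suml.
  by rewrite sm divff.
have vQ i j : Q i j * v j = m i j.
  rewrite /Q; case: ifPn => [/eqP vj|vj]; last by rewrite divfK.
  have /eqP := sm j; rewrite vj psumr_eq0//= => /allP/(_ i (mem_index_enum _))/eqP ->.
  by rewrite mulr0.
pose P i y := \sum_j Q i j * pou_bump (j : J) y.
have cP i : continuous (P i).
  by apply: continuous_sum => j _ y; apply: cvgM; [exact: cvg_cst|exact: pou_bump_continuous].
exists I, w, P; split.
- by move=> i; exact: (hw i).1.
- exact: cP.
- by move=> i y; apply: sumr_ge0 => j _; rewrite mulr_ge0// pou_bump_ge0.
- move=> y; rewrite exchange_big/=.
  by under eq_bigr do rewrite -mulr_suml sQ mul1r; exact: pou_bump_sum.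
move=> k kd.
(* [D] freezes the second argument of [F k] at the centers. The comparison runs from the kernel
   integral to [D], then to [U] on the product, then to [F k]. *)
pose D y := \sum_j (\sum_i Q i j * F k (w i, pou_center j)) * pou_bump (j : J) y.
have cpair (x : X) : continuous (fun y : Y => (x, y)).
  move=> y; have h1 : (fun _ : Y => x) @ y --> x by exact: (@cst_continuous Y X x y).
  have h2 : (fun y : Y => y) @ y --> y by exact: cvg_id.
  exact: (cvg_pair h1 h2).
have cFw i : continuous (fun y => F k (w i, y)).
  by move=> y; apply: continuous_comp; [exact: cpair|exact: cF].
have cH : continuous (fun y => \sum_i P i y * F k (w i, y)).
  by apply: continuous_sum => i _ y; apply: cvgM; [exact: cP|exact: cFw].
have cDj (j : J) : continuous (fun y => (\sum_i Q i j * F k (w i, pou_center j)) * pou_bump j y).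
  by move=> y; apply: cvgM; [exact: cvg_cst|exact: pou_bump_continuous].
have cD : continuous D by exact: continuous_sum.
pose U z := \sum_ij F k (w ij.1, pou_center ij.2) * pou_bump (ij : pou_index (pou_prod p q)) z.
have cUij (ij : pou_index (pou_prod p q)) :
    continuous (fun z => F k (w ij.1, pou_center ij.2) * pou_bump ij z).
  by move=> z; apply: cvgM; [exact: cvg_cst|exact: pou_bump_continuous].
have cU : continuous U by exact: continuous_sum.
(* Both integrals are the same finite double sum, because [Q i j * v j] is the [xi]-mass [m i j]. *)
have DU : \int[nu]_y D y = \int[xi]_z U z.
  rewrite !cintegral_sum//.
  rewrite -(pair_bigA _ (fun i j => \int[xi]_z
    (F k (w i, pou_center j) * (pou_bump (i : I) z.1 * pou_bump (j : J) z.2))))/=.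
  rewrite exchange_big/=; apply: eq_bigr => j _.
  rewrite cintegralZ//; last exact: pou_bump_continuous.
  rewrite -/(v j) mulr_suml; apply: eq_bigr => i _.
  by rewrite cintegralZ// -/(m i j) -vQ; ring.
have HD : `|\int[nu]_y (\sum_i P i y * F k (w i, y)) - \int[nu]_y D y| <= e.
  rewrite -cintegralB//; apply: norm_cintegral_bound => //.
    by move=> y; apply: cvgB; [exact: cH|exact: cD].
  move=> y.
  have -> : \sum_i P i y * F k (w i, y) - D y =
      \sum_j pou_bump (j : J) y * \sum_i Q i j * (F k (w i, y) - F k (w i, pou_center j)).
    rewrite /P; under eq_bigr do rewrite mulr_suml.
    rewrite exchange_big/= -sumrB; apply: eq_bigr => j _.
    rewrite mulr_suml mulr_sumr -sumrB; apply: eq_bigr => i _; ring.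
  rewrite (le_trans (ler_norm_sum _ _ _))// -[e]mul1r -(pou_bump_sum q y) mulr_suml.
  apply: ler_sum => j _; rewrite normrM (ger0_norm (pou_bump_ge0 j y)).
  have := pou_bump_ge0 j y; rewrite le_eqVlt => /orP[/eqP <-|jy]; first by rewrite !mul0r.
  rewrite ler_pM2l// (le_trans (ler_norm_sum _ _ _))// -[e]mul1r -(sQ j) mulr_suml.
  apply: ler_sum => i _; rewrite normrM (ger0_norm (Q0 i j)) ler_wpM2l// ltW//.
  apply: hdelta => //; first by rewrite mdistxx.
  by rewrite metric_sym hq.
(* Over [G] the representative is within [delta] of the first coordinate; over its complement the
   crude bound [2 * C] is paid on mass [eta]. The first marginal of [xi] transfers the bound on that
   mass. *)
have UF : `|\int[xi]_z U z - \int[xi]_z F k z| <= e + 2 * C * eta.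
  rewrite -cintegralB//.
  have mfst := continuous_borel_measurable cfst.
  have mG' : measurable ((@fst X Y : borel (X * Y)%type -> borel X) @^-1` G).
    by rewrite -[X in measurable X]setTI; exact: mfst.
  apply: (norm_cintegral_le cXY _ mG').
  - by move=> z; apply: cvgB; [exact: cU|exact: cF].
  - move=> [x y] Gx; apply: (@pou_average _ _ (pou_prod p q) (x, y)) => -[i j] /= ij.
    have bi : 0 < pou_bump i x.
      rewrite lt_neqAle pou_bump_ge0 andbT; apply: contraTneq ij => <-.
      by rewrite mul0r ltxx.
    have bj : 0 < pou_bump j y by move: ij; rewrite pmulr_rgt0.
    apply/ltW/hdelta => //; last exact: hq.
    have iw : 0 < pou_bump i (w i) by apply: (hw i).2; exists x.
    have := metric_triangle (w i) (pou_center i) x; rewrite (metric_sym (w i) (pou_center i)).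
    by have := hp _ _ bi; have := hp _ _ iw; lra.
  - move=> z; apply: (@pou_average _ _ (pou_prod p q) z) => ij _.
    have := FC k (w ij.1, pou_center ij.2) kd; have := FC k z kd.
    by rewrite !ler_norml => /andP[? ?] /andP[? ?]; apply/andP; split; lra.
  - exact: ltW.
  - by rewrite mulr_ge0.
  - have mGC : measurable (~` G) by exact: measurableC.
    by rewrite preimage_setC (marg.1 _ mGC).
rewrite -DU in UF.
by move: HD UF; rewrite !ler_norml => /andP[? ?] /andP[? ?]; apply/andP; split; lra.
Qed.

End Kernel.

(** * Greedy choices and shadowing *)

Section FiniteSums.
Context (R : realType).
Implicit Types (a : nat -> R).

Lemma sum_ordD a m n : \sum_(i < m + n) a i = \sum_(i < m) a i + \sum_(i < n) a (m + i)%N.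
Proof. by rewrite big_split_ord. Qed.

Lemma sum_ordM a q m : \sum_(i < q * m) a i = \sum_(j < q) \sum_(i < m) a (j * m + i)%N.
Proof.
elim: q => [|q ih]; first by rewrite mul0n !big_ord0.
by rewrite mulSnr sum_ordD ih big_ord_recr.
Qed.

Lemma sum_ord_subn a m n : (m <= n)%N ->
  \sum_(i < n) a i = \sum_(i < m) a i + \sum_(i < n - m) a (m + i)%N.
Proof. by move=> mn; rewrite -sum_ordD subnKC. Qed.

Lemma sum_ord_divn a n L :
  \sum_(i < n) a i = \sum_(j < n %/ L) \sum_(i < L) a (j * L + i)%N +
    \sum_(i < n %% L) a (n %/ L * L + i)%N.
Proof. by rewrite -sum_ordM -sum_ordD -divn_eq. Qed.

Lemma norm_sum_le a n (e : R) : (forall i, (i < n)%N -> `|a i| <= e) ->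
  `|\sum_(i < n) a i| <= e * n%:R.
Proof.
move=> h; rewrite (le_trans (ler_norm_sum _ _ _))// mulr_natr -[n in _ *+ n]card_ord -sumr_const.
by apply: ler_sum => i _; exact: h.
Qed.

Lemma exists_le_average (I : finType) (P a : I -> R) : (forall i, 0 <= P i) ->
  \sum_i P i = 1 -> exists i, a i <= \sum_i P i * a i.
Proof.
move=> P0 P1; apply: contrapT => /forallNP h.
have {}h i : \sum_i P i * a i < a i by rewrite ltNge; apply/negP; exact: h.
have [i0 Pi0] : exists i, 0 < P i.
  apply: contrapT => /forallNP nP; have := P1; rewrite big1 => [/eqP|i _].
    by rewrite eq_sym oner_eq0.
  by apply/eqP; rewrite eq_le P0 andbT leNgt; apply/negP; exact: nP.
have : \sum_i P i * (\sum_j P j * a j) < \sum_i P i * a i.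
  rewrite (bigD1 i0)//= [X in _ < X](bigD1 i0)//=.
  rewrite ltr_leD//; first by rewrite ltr_pM2l.
  by apply: ler_sum => i _; rewrite ler_wpM2l// ltW.
by rewrite -mulr_suml P1 mul1r ltxx.
Qed.

(* Choosing each step with nonpositive inner product with the running total keeps
   the squared norm of the total below [N * d * B ^ 2]. *)
Lemma greedy_choice (C : Type) (d : nat) (v : nat -> C -> nat -> R) (B eta : R) :
  (forall n c k, (k < d)%N -> `|v n c k| <= B) -> 0 < eta ->
  (forall n (V : nat -> R), exists c, \sum_(k < d) V k * v n c k <= 0) ->
  exists c : nat -> C, forall N k, (k < d)%N ->
    `|\sum_(n < N) v n (c n) k| <= eta * N%:R + d%:R * B ^+ 2 / eta.
Proof.
move=> vB eta0 hv.
have /choice[sel hsel] (nV : nat * (nat -> R)) :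
    exists c, \sum_(k < d) nV.2 k * v nV.1 c k <= 0 by exact: hv.
pose V := fix V n : nat -> R :=
  if n is n'.+1 then fun k => V n' k + v n' (sel (n', V n')) k else fun=> 0.
pose c n := sel (n, V n); exists c.
have VE n k : V n k = \sum_(i < n) v i (c i) k.
  by elim: n => [|n ih]; rewrite ?big_ord0// big_ord_recr/= ih.
have sqV n : \sum_(k < d) V n k ^+ 2 <= n%:R * (d%:R * B ^+ 2).
  elim: n => [|n ih]; first by rewrite big1 ?mul0r// => k _; rewrite /= expr0n.
  have -> : \sum_(k < d) V n.+1 k ^+ 2 = \sum_(k < d) V n k ^+ 2 +
      2 * (\sum_(k < d) V n k * v n (c n) k) + \sum_(k < d) v n (c n) k ^+ 2.
    rewrite mulr_sumr -!big_split/=; apply: eq_bigr => k _.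
    by rewrite -/(c n); ring.
  have h1 : \sum_(k < d) V n k * v n (c n) k <= 0 := hsel (n, V n).
  have h2 : \sum_(k < d) v n (c n) k ^+ 2 <= d%:R * B ^+ 2.
    rewrite mulr_natl -[X in _ *+ X]card_ord -sumr_const; apply: ler_sum => k _.
    by rewrite -real_normK ?num_real// lerXn2r ?nnegrE ?(le_trans _ (vB n (c n) k _))// vB.
  rewrite -natr1 mulrDl mul1r; lra.
move=> N k kd; rewrite -VE.
set D := d%:R * B ^+ 2; have D0 : 0 <= D by rewrite mulr_ge0// sqr_ge0.
have hV : V N k ^+ 2 <= N%:R * D.
  apply: le_trans (sqV N); rewrite (bigD1 (Ordinal kd))//= lerDl.
  by apply: sumr_ge0 => i _; exact: sqr_ge0.
have N0 : 0 <= N%:R :> R by rewrite ler0n.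
have r0 : 0 <= eta * N%:R + D / eta.
  by apply: addr_ge0; [apply: mulr_ge0|apply: divr_ge0] => //; exact: ltW.
rewrite -ler_sqr ?nnegrE// real_normK ?num_real//.
apply: le_trans hV _.
(* The cross term [2 * (N%:R * D)] alone dominates [N%:R * D]; this trades square-root growth for an
   arbitrarily small slope plus a constant. *)
have -> : (eta * N%:R + D / eta) ^+ 2 =
    (eta * N%:R) ^+ 2 + 2 * (N%:R * D) + (D / eta) ^+ 2.
  by field; rewrite gt_eqF.
have := sqr_ge0 (eta * N%:R); have := sqr_ge0 (D / eta).
have : 0 <= N%:R * D by rewrite mulr_ge0.
lra.
Qed.

(* A stretch has room for [q.+1] blocks but contains only [q], so that any offset
   [s <= m] fits; the first [g] entries of each block form the gap. *)
Lemma stretch_sum (a : nat -> R) (b : nat -> nat -> R) (q m g s : nat) (e C : R) :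
  (g <= m)%N -> (s <= m)%N -> 0 <= C -> 0 <= e -> (forall n, `|a n| <= C) ->
  (forall j i, (j < q)%N -> `|b j i| <= C) ->
  (forall j i, (j < q)%N -> (g <= i < m)%N -> `|a (s + j * m + i)%N - b j i| <= e) ->
  `|\sum_(n < q.+1 * m) a n - \sum_(j < q) \sum_(i < m) b j i| <=
    (e * m%:R + 2 * C * g%:R) * q%:R + C * m%:R.
Proof.
move=> gm sm C0 e0 aC bC ab.
(* Head of length [s], then [q] blocks, then a tail of length [m - s]: head and tail together cost
   [C * m], and each block costs [e * m] for shadowing and [2 * C * g] for its gap. *)
have -> : (q.+1 * m = s + (q * m + (m - s)))%N by lia.
rewrite (sum_ordD a) (sum_ordD (fun i => a (s + i)%N)) (sum_ordM (fun i => a (s + i)%N)).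
set A := \sum_(i < s) _; set B := \sum_(j < q) _; set D := \sum_(i < m - s) _.
have hA : `|A| <= C * s%:R by apply: norm_sum_le => i _; exact: aC.
have hD : `|D| <= C * (m - s)%:R.
  by apply: (@norm_sum_le (fun i => a (s + (q * m + i))%N)) => i _; exact: aC.
rewrite natrB// in hD.
set E := \sum_(j < q) _.
have hBE : `|B - E| <= (e * m%:R + 2 * C * g%:R) * q%:R.
  rewrite /B /E -sumrB.
  apply: (@norm_sum_le (fun j => \sum_(i < m) a (s + (j * m + i))%N - \sum_(i < m) b j i)) => j jq.
  rewrite -sumrB (sum_ord_subn (fun i => a (s + (j * m + i))%N - b j i) gm).
  rewrite (le_trans (ler_normD _ _))// addrC lerD//.
    apply: (@le_trans _ _ (e * (m - g)%:R)).
      apply: (@norm_sum_le (fun i => a (s + (j * m + (g + i)))%N - b j (g + i)%N)) => i im.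
      by rewrite addnA; apply: ab => //; lia.
    by rewrite ler_wpM2l// ler_nat; lia.
  apply: (@norm_sum_le (fun i => a (s + (j * m + i))%N - b j i)) => i _.
  have := aC (s + (j * m + i))%N; have := bC j i jq.
  by rewrite !ler_norml => /andP[? ?] /andP[? ?]; apply/andP; split; lra.
rewrite (_ : _ - E = A + (B - E) + D); last by ring.
have := ler_normD (A + (B - E)) D; have := ler_normD A (B - E).
lra.
Qed.

End FiniteSums.

(** * Shadowing an initial orbit segment followed by blocks *)

Section ShadowingBlocks.
Context (R : realType) (X : pmetricType R) (T : X -> X).

Lemma iter_surj n : set_surj [set: X] [set: X] T -> forall x, exists u, iter n T u = x.
Proof.
move=> sT; elim: n => [|n ih] x; first by exists x.
have [x' _ <-] := sT x I; have [u <-] := ih x'.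
by exists u.
Qed.

(** Every segment after the first has length [m - g], so gaps of length [g] suffice however long the
    initial segment [t] is. *)
Lemma shadow_blocks (e : R) (M : nat -> nat) (z : X) (t m g N : nat)
    (p : nat -> nat) (w : nat -> X) :
  set_surj [set: X] [set: X] T ->
  (forall K a b Sp, specification T K a b Sp ->
      (forall N, (N.+1 < K)%N -> (M (seg_length a b N.+1) <= gap a b N)%N) ->
      exists x : X, shadows T e K a b Sp x) ->
  (0 < t)%N -> (g < m)%N -> (M (m - g) <= g)%N -> (t <= p 0)%N ->
  (forall r, (p r + m <= p r.+1)%N) ->
  exists x, (forall n, (n < t)%N -> mdist (iter n T z) (iter n T x) < e) /\
    forall r i, (r < N)%N -> (g <= i < m)%N ->
      mdist (iter i T (w r)) (iter (p r + i) T x) < e.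
Proof.
move=> sT hM t0 gm Mg tp pS.
have pm r r' : (r < r')%N -> (p r + m <= p r')%N.
  elim: r' => // r' ih; rewrite ltnS leq_eqVlt => /orP[/eqP ->|/ih h]; first exact: pS.
  by have := pS r'; lia.
have tpr r : (t <= p r)%N by case: r => // r; have := pm 0%N r.+1 isT; lia.
(* A specification is indexed by absolute time, so the block point [w r] is pulled back along
   [iter (p r) T] by surjectivity. *)
have /choice[u hu] r : exists u, iter (p r) T u = w r by exact: iter_surj.
(* The block containing time [n]; the blocks are disjoint, and the default 0 is never read at a time
   inside a segment. *)
pose idx n := xget 0%N [set r | (p r <= n < p r + m)%N].
have idxE r i : (i < m)%N -> idx (p r + i)%N = r.
  move=> im; have : [set r' | (p r' <= p r + i < p r' + m)%N] (idx (p r + i)%N).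
    by apply: (@xgetPex _ 0%N); exists r => /=; lia.
  move: (idx _) => r' /= h.
  by have [/pm|/pm|//] := ltngtP r' r; lia.
(* Segment 0 is the initial orbit on [[0, t - 1]]; segment [r.+1] is block [r] without its first [g]
   times. *)
pose a r := if r is r'.+1 then (p r' + g)%N else 0%N.
pose b r := if r is r'.+1 then (p r' + m).-1 else t.-1.
pose Sp n := if (n < t)%N then iter n T z else iter n T (u (idx n)).
have [||x hx] := hM N.+1 a b Sp.
- split=> //.
  + by case=> [|r] _ /=; lia.
  + by case=> [|r] _ /=; [have := tpr 0%N|have := pS r]; lia.
  + case=> [|r] _ /=; first by exists z => n nt; rewrite /Sp ifT//; lia.
    exists (u r) => n hn; rewrite /Sp ifF; last by have := tpr r; lia.
    by rewrite -(_ : (p r + (n - p r) = n)%N) ?idxE//; lia.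
- move=> r _; rewrite /seg_length /gap /=.
  have -> : ((p r + m).-1 - (p r + g)).+1 = (m - g)%N by lia.
  apply: (leq_trans Mg); case: r => [|r] /=; first by have := tpr 0%N; lia.
  by have := pS r; lia.
exists x; split=> [n nt|r i rN im].
  have := hx n; rewrite /Sp nt; apply; exists 0%N => //=; lia.
have := hx (p r + i)%N; rewrite /Sp ifF; last by have := tpr r; lia.
rewrite idxE; last by lia.
by rewrite addnC !iterD hu; apply; exists r.+1 => //=; lia.
Qed.

End ShadowingBlocks.

(** * Deterministic choice of offsets and blocks *)

Section Blocks.
Context (R : realType) (X Y : Type).

(* [base tau] is the start of the stretch [tau], [s tau] the offset of its blocks and
   [iota tau j] the label of its [j]-th block.  Averaging over all offsets in [0, m)
   turns the sum over block starts into the sum over all times of the stretch. *)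
Lemma joint_blocks (A : nat -> X * Y -> R) (d m q : nat) (C e : R) (I : finType)
    (w : I -> X) (P : I -> Y -> R) (yy : nat -> Y) (base : nat -> nat) :
  (0 < m)%N -> 0 < e -> (forall k z, (k < d)%N -> `|A k z| <= C) ->
  (forall i y, 0 <= P i y) -> (forall y, \sum_i P i y = 1) ->
  exists (s : nat -> nat) (iota : nat -> nat -> I), (forall tau, (s tau < m)%N) /\
    forall N k, (k < d)%N ->
    `|\sum_(tau < N) (\sum_(j < q) m%:R * A k (w (iota tau j), yy (base tau + s tau + j * m)%N)
        - \sum_(n < q * m) \sum_i P i (yy (base tau + n)%N) * A k (w i, yy (base tau + n)%N))|
      <= e * N%:R + d%:R * (2 * C * (q * m)%:R) ^+ 2 / e.
Proof.
move=> m0 e0 AC P0 P1.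
pose G k y := \sum_i P i y * A k (w i, y).
have GC k y : (k < d)%N -> `|G k y| <= C.
  move=> kd; rewrite (le_trans (ler_norm_sum _ _ _))// -[C]mul1r -(P1 y) mulr_suml.
  by apply: ler_sum => i _; rewrite normrM (ger0_norm (P0 i y)) ler_wpM2l// AC.
(* One greedy step per stretch: the choice consists of an offset and all [q] block labels, and [v]
   is the resulting discrepancy vector. *)
pose v tau (c : 'I_m * (nat -> I)) k :=
  \sum_(j < q) m%:R * A k (w (c.2 j), yy (base tau + c.1 + j * m)%N)
  - \sum_(n < q * m) G k (yy (base tau + n)%N).
have [||| c hc] := @greedy_choice R _ d v (2 * C * (q * m)%:R) e.
- move=> tau c k kd; rewrite (le_trans (ler_normB _ _))//.
  have -> : 2 * C * (q * m)%:R = (m%:R * C) * q%:R + C * (q * m)%:R by rewrite natrM; ring.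
  apply: lerD; last by apply: (@norm_sum_le _ (fun n => G k (yy (base tau + n)%N))) => n _; exact: GC.
  apply: (@norm_sum_le _ (fun j => m%:R * A k (w (c.2 j), yy (base tau + c.1 + j * m)%N))) => j _.
  by rewrite normrM ger0_norm// ler_wpM2l// AC.
- exact: e0.
- move=> tau V.
  (* The offset is chosen first, against the conditional means [G]. Uniform averaging over offsets
     visits each of the [q * m] times exactly once and cancels the factor [m]. *)
  have [||s hs] := @exists_le_average R 'I_m (fun=> m%:R^-1)
    (fun s => \sum_(k < d) V k * \sum_(j < q) m%:R * G k (yy (base tau + s + j * m)%N)).
  + by move=> _; rewrite invr_ge0.
  + by rewrite sumr_const card_ord -[_ *+ m]mulr_natl divff// pnatr_eq0; lia.
  (* With the offset fixed, each label is chosen separately, doing at least as well as its average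
     under [P]. *)
  have /choice[ii hii] (j : nat) : exists i, \sum_(k < d) V k * A k (w i, yy (base tau + s + j * m)%N)
      <= \sum_(k < d) V k * G k (yy (base tau + s + j * m)%N).
    have [||i hi] := @exists_le_average R I (fun i => P i (yy (base tau + s + j * m)%N))
      (fun i => \sum_(k < d) V k * A k (w i, yy (base tau + s + j * m)%N)); [by []|by []|].
    exists i; apply: (le_trans hi); rewrite le_eqVlt; apply/orP; left; apply/eqP.
    under eq_bigr do rewrite mulr_sumr.
    rewrite exchange_big/=; apply: eq_bigr => k _; rewrite /G mulr_sumr.
    by apply: eq_bigr => i' _; ring.
  exists (s, ii); rewrite /v/=.
  under eq_bigr do rewrite mulrBr; rewrite sumrB subr_le0.
  apply: (@le_trans _ _ (\sum_(k < d) V k * \sum_(j < q) m%:R * G k (yy (base tau + s + j * m)%N))).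
    under eq_bigr do rewrite mulr_sumr.
    under [X in _ <= X]eq_bigr do rewrite mulr_sumr.
    rewrite exchange_big/= [X in _ <= X]exchange_big/=; apply: ler_sum => j _.
    under eq_bigr do rewrite mulrCA.
    under [X in _ <= X]eq_bigr do rewrite mulrCA.
    by rewrite -!mulr_sumr ler_wpM2l.
  apply: (le_trans hs); rewrite le_eqVlt; apply/orP; left; apply/eqP.
  under eq_bigr do rewrite mulr_sumr.
  rewrite exchange_big/=; apply: eq_bigr => k _.
  have mm : m%:R != 0 :> R by rewrite pnatr_eq0; lia.
  under eq_bigr do rewrite mulrCA mulr_sumr.
  rewrite -mulr_sumr; congr (_ * _).
  rewrite (sum_ordM (fun n => G k (yy (base tau + n)%N))) exchange_big/=.
  apply: eq_bigr => j _; apply: eq_bigr => i _.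
  by rewrite mulKf// -addnA [(i + _)%N]addnC.
exists (fun tau => (c tau).1), (fun tau => (c tau).2); split=> // tau.
Qed.

(** Block [r] is number [r %% q] of stretch [r %/ q]. At the passage to the next stretch, the spare
    slot of length [m] absorbs the offset [s tau < m]. *)
Lemma block_starts (t m q : nat) (s : nat -> nat) (p := fun r =>
    (t + (r %/ q) * (q.+1 * m) + s (r %/ q) + (r %% q) * m)%N) :
  (0 < q)%N -> (forall tau, (s tau < m)%N) -> forall r, (p r + m <= p r.+1)%N.
Proof.
move=> q0 sm r; rewrite /p.
have := ltn_pmod r q0; rewrite leq_eqVlt => /orP[/eqP rq|rq].
  have -> : (r.+1 %/ q = (r %/ q).+1)%N.
    by rewrite {1}(divn_eq r q) -addnS rq -mulSnr mulnK.
  have -> : (r.+1 %% q = 0)%N by rewrite {1}(divn_eq r q) -addnS rq -mulSnr modnMl.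
  have := sm (r %/ q)%N.
  have -> : ((r %/ q).+1 * (q.+1 * m) = r %/ q * (q.+1 * m) + (r %% q * m + m + m))%N.
    have qm : (q * m = r %% q * m + m)%N by rewrite -{1}rq mulSnr.
    by rewrite mulSnr [X in (_ + X)%N]mulSnr qm.
  lia.
have -> : (r.+1 %/ q = r %/ q)%N.
  by rewrite {1}(divn_eq r q) -addnS divnMDl// (divn_small rq) addn0.
have -> : (r.+1 %% q = (r %% q).+1)%N.
  by rewrite {1}(divn_eq r q) -addnS modnMDl (modn_small rq).
by rewrite mulSnr; lia.
Qed.

End Blocks.

(** * Extending an orbit segment *)

Lemma norm_le_of_dist (R : realType) (a b x y z : R) :
  `|a - b| <= x -> `|b| <= y -> x + y <= z -> `|a| <= z.
Proof.
by move=> ab hb xyz; rewrite -[a](subrK b) (le_trans (ler_normD _ _))//; lra.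
Qed.

(** In units of [e * q * m]: shadowing costs one, the gaps two and the spare slot one. *)
Lemma stretch_error (R : realType) (e m q C g : R) : C * g * q <= e * m * q ->
  C * m <= e * q * m -> 0 <= e * m ->
  (e * m + 2 * C * g) * q + C * m <= 4 * e * (q * m + m).
Proof. lra. Qed.

(** The chain runs from the orbit sum to the block sum [E] (4 units), to the kernel sum [G] over the
    block times (1), to all stretch times (1), to the full orbit sum of kernel means (4). Heads,
    tails and the greedy constant cost the eleventh unit. *)
Lemma assemble_error (R : realType) (a1 a2 a3 g1 g2 g3 E G B D K x y z : R) :
  `|g3| <= D -> `|g1| <= B -> `|a3| <= D -> `|a1| <= B ->
  `|g1 + (g2 + g3)| <= 4 * x -> `|a2 - E| <= 4 * y -> `|E - G| <= z + K ->
  `|g2 - G| <= y -> y <= x -> z <= x -> 2 * B + 2 * D + K <= x ->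
  `|a1 + (a2 + a3)| <= 11 * x.
Proof.
rewrite !ler_norml => /andP[? ?] /andP[? ?] /andP[? ?] /andP[? ?] /andP[? ?] /andP[? ?].
by move=> /andP[? ?] /andP[? ?] ? ? ?; apply/andP; split; lra.
Qed.

Lemma iter_prod_map (X Y : Type) (T : X -> X) (S : Y -> Y) n z :
  iter n (prod_map T S) z = (iter n T z.1, iter n S z.2).
Proof. by elim: n => [|n /= ->]//; case: z. Qed.

Section Extension.
Context (R : realType) (X Y : pmetricType R) (T : X -> X) (S : Y -> Y).
Hypotheses (cX : compact [set: X]) (cY : compact [set: Y]).
Hypotheses (cT : continuous T) (cS : continuous S).
Hypothesis sT : set_surj [set: X] [set: X] T.
Variables (xi : probability (borel (X * Y)%type) R).
Variables (mu : probability (borel X) R) (nu : probability (borel Y) R).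
Hypothesis ixi : invariant_measure (prod_map T S) xi.
Hypothesis marg : marginals xi mu nu.
Hypothesis hspec : weak_specification T.
Hypothesis emu : ergodic T mu.
Variables (y : Y) (n_ : nat -> nat).
Hypothesis n_lt : {homo n_ : i j / (i < j)%N}.
Hypothesis hy : weak_star_cvg (fun k => emp R S y 0 (n_ k)) nu.

Let cXY : compact [set: X * Y].
Proof. by rewrite -setXTT; exact: compact_setX. Qed.

Let W := prod_map T S.

Let cfst : continuous (@fst X Y). Proof. by move=> z; exact: cvg_fst. Qed.
Let csnd : continuous (@snd X Y). Proof. by move=> z; exact: cvg_snd. Qed.

Lemma continuous_prod_map : continuous W.
Proof.
move=> z.
have h1 : (fun z : X * Y => T z.1) @ z --> T z.1.
  by apply: continuous_comp; [exact: cfst|exact: cT].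
have h2 : (fun z : X * Y => S z.2) @ z --> S z.2.
  by apply: continuous_comp; [exact: csnd|exact: cS].
exact: (cvg_pair h1 h2).
Qed.

Lemma cintegral_orbit_average (F : X * Y -> R) (m : nat) : continuous F -> (0 < m)%N ->
  continuous (fun z => m%:R^-1 * \sum_(i < m) F (iter i W z)) /\
  \int[xi]_z (m%:R^-1 * \sum_(i < m) F (iter i W z)) = \int[xi]_z F z.
Proof.
move=> cF m0.
have cFi i : continuous (fun z => F (iter i W z)).
  move=> z; apply: continuous_comp; last exact: cF.
  exact: (continuous_iter continuous_prod_map).
have cs : continuous (fun z => \sum_(i < m) F (iter i W z)) by exact: continuous_sum.
split; first by move=> z; apply: cvgM; [exact: cvg_cst|exact: cs].
rewrite cintegralZ// cintegral_sum//.
have h i : \int[xi]_z F (iter i W z) = \int[xi]_z F z.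
  elim: i => [//|i ih]; rewrite -ih.
  under eq_Rintegral do rewrite iterSr.
  exact: (cintegral_invariant continuous_prod_map cXY ixi (cFi i)).
under eq_bigr do rewrite h.
by rewrite sumr_const card_ord -[X in _ * X]mulr_natl mulKf// pnatr_eq0; lia.
Qed.

Lemma orbit_average_bound (F : X * Y -> R) (m : nat) (C : R) : (0 < m)%N ->
  (forall z, `|F z| <= C) -> forall z, `|m%:R^-1 * \sum_(i < m) F (iter i W z)| <= C.
Proof.
move=> m0 FC z; have mp : 0 < m%:R :> R by rewrite ltr0n.
rewrite normrM ger0_norm ?invr_ge0// mulrC ler_pdivrMr//.
by apply: (@norm_sum_le _ (fun i => F (iter i W z))).
Qed.

Lemma quasi_generic_sum (G : nat -> Y -> R) (d : nat) (r e : R) :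
  (forall k, (k < d)%N -> continuous (G k)) ->
  (forall k, (k < d)%N -> `|\int[nu]_x G k x| <= r) -> 0 < e ->
  exists k0, forall k, (k0 <= k)%N -> forall i, (i < d)%N ->
    `|\sum_(p < (n_ k).+1) G i (iter p S y)| <= (r + e) * (n_ k).+1%:R.
Proof.
move=> cG Gr e0; elim: d cG Gr => [|d ih] cG Gr; first by exists 0%N.
have [||k0 hk0] := ih; [by move=> k kd; apply: cG; exact: ltnW|by move=> k kd; apply: Gr; exact: ltnW|].
have := hy (cG d (ltnSn d)); move=> /cvgrPdist_le/(_ _ e0)[k1 _ hk1].
exists (maxn k0 k1) => k; rewrite geq_max => /andP[kk0 kk1] i.
rewrite ltnS leq_eqVlt => /orP[/eqP ->|id]; last exact: hk0.
have := hk1 k kk1; rewrite /= (cintegral_emp cY)//; last exact: cG.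
set sm := \sum_(p < _) _; pose u := \int[nu]_x G d x.
rewrite -[X in `|X - _|]/u; set v := _ * sm => h; have hr : `|u| <= r := Gr d (ltnSn d).
have : `|v| <= r + e.
  by clearbody u v; move: hr h; rewrite !ler_norml => /andP[? ?] /andP[? ?]; apply/andP; split; lra.
have n0 : 0 < (n_ k).+1%:R :> R by rewrite ltr0n.
by rewrite /v normrM ger0_norm ?invr_ge0// mulrC ler_pdivrMr.
Qed.

Lemma common_bound (f : nat -> X -> R) (F : nat -> X * Y -> R) (d : nat) :
  (forall k, continuous (f k)) -> (forall k, continuous (F k)) ->
  exists2 C : R, 1 <= C & forall k, (k < d)%N ->
    (forall x, `|f k x| <= C) /\ (forall z, `|F k z| <= C).
Proof.
move=> cf cF; elim: d => [|d [C C1 hC]]; first by exists 1.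
have [C2 C20 hC2] := compact_continuous_bounded cX (cf d).
have [C3 C30 hC3] := compact_continuous_bounded cXY (cF d).
exists (C + C2 + C3) => [|k]; first by lra.
rewrite ltnS leq_eqVlt => /orP[/eqP ->|/hC[h1 h2]]; split=> z.
- by have := hC2 z; lra.
- by have := hC3 z; lra.
- by have := h1 z; lra.
- by have := h2 z; lra.
Qed.

Lemma gap_length (M : nat -> nat) (m0 : nat) (c : R) :
  (fun l => (M l)%:R / l%:R : R) @ \oo --> (0 : R) -> 0 < c ->
  exists l, [/\ (m0 <= l)%N, (0 < l)%N & (M l)%:R <= c * l%:R].
Proof.
move=> hM c0; move: hM => /cvgrPdist_le/(_ _ c0)[l0 _ hl0].
exists (maxn l0 m0).+1; split=> //; first by rewrite (leq_trans (leq_maxr l0 m0)).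
have := hl0 (maxn l0 m0).+1; rewrite /= sub0r normrN => h.
have {h} := h (leq_trans (leq_maxl _ _) (leqnSn _)).
by rewrite ger0_norm ?divr_ge0// ler_pdivrMr// ltr0n.
Qed.

(** The loss [L] covers one incomplete stretch and is fixed before [z] and [t], so a later stage can
    wait until it is negligible. The [f]-sums are controlled on all windows starting at [t], as
    genericity needs; the [F]-sums only up to the times given by [n_]. *)
Lemma extension_normalized (f : nat -> X -> R) (F : nat -> X * Y -> R) (d : nat) (e : R) :
  (forall k, continuous (f k)) -> (forall k, continuous (F k)) ->
  (forall k, \int[mu]_x f k x = 0) -> (forall k, \int[xi]_z F k z = 0) -> 0 < e ->
  exists2 L : R, 0 <= L & forall z t, (0 < t)%N -> exists k0, forall k, (k0 <= k)%N ->
    exists z', [/\ forall n, (n < t)%N -> mdist (iter n T z) (iter n T z') < e,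
      forall i n, (i < d)%N -> (t + n <= (n_ k).+1)%N ->
        `|\sum_(j < n) f i (iter (t + j) T z')| <= e * n%:R + L &
      forall i, (i < d)%N ->
        `|\sum_(j < (n_ k).+1) F i (iter j T z', iter j S y)| <= e * (n_ k).+1%:R].
Proof.
move=> cf cF if0 iF0 e0.
have [C C1 fFC] := common_bound d cf cF.
have C0 : 0 < C by lra.
pose e1 := e / 11.
have e10 : 0 < e1 by rewrite divr_gt0.
have eE : e = 11 * e1 by rewrite /e1; lra.
clearbody e1.
have [dF dF0 hdF] := uniform_modulus cX cY d cF e10.
have [df df0 hdf] : exists2 delta : R, 0 < delta & forall k, (k < d)%N -> forall x x' (y y' : Y),
    mdist x x' < delta -> mdist y y' < delta -> `|f k x - f k x'| < e1.
  apply: (uniform_modulus cX cY d (F := fun k z => f k z.1)) => // k z.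
  by apply: continuous_comp; [exact: cfst|exact: cf].
pose delta := Num.min e (Num.min dF df).
have delta0 : 0 < delta by rewrite !lt_min e0 dF0.
have [M [Mcvg hM]] := hspec delta0.
(* Below 1 so that the good set is nonempty, and small enough that [2 * C * eta] is at most [e1]. *)
pose eta := Num.min (1 / 2) (e1 / (2 * C)).
have eta0 : 0 < eta by rewrite lt_min !divr_gt0// mulr_gt0.
have eta1 : eta < 1 by rewrite gt_min; apply/orP; left; lra.
have Ceta : 2 * C * eta <= e1.
  by rewrite mulrC -ler_pdivlMr ?mulr_gt0// /eta ge_min lexx orbT.
have [m0 hm0] := ergodic_averages cT cX emu d cf e10 eta0.
have [l [m0l l0 hl]] := gap_length m0 Mcvg (divr_gt0 e10 C0).
(* A block consists of a gap [g] and a shadowed part of length [l], with [l] so long that the gap is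
   a negligible fraction. *)
pose g := M l; pose m := (l + g)%N.
have m0' : (0 < m)%N by rewrite /m addn_gt0 l0.
have Cg : C * g%:R <= e1 * m%:R.
  apply: (@le_trans _ _ (e1 * l%:R)).
    by rewrite mulrC -ler_pdivlMr// mulrAC.
  by rewrite ler_wpM2l ?ler_nat ?leq_addr// ltW.
have [mG muG] := hm0 m (leq_trans m0l (leq_addr _ _)).
have [q q0 Cq] : exists2 q, (0 < q)%N & C <= e1 * q%:R.
  exists (Num.truncn (C / e1)).+1 => //.
  by rewrite mulrC -ler_pdivrMr// ltW// truncnS_gt.
(* The kernel is applied to averages over a whole block, so one label drawn at the block start
   controls the entire pair sum along it. *)
pose A k z := m%:R^-1 * \sum_(i < m) F k (iter i W z).
have cA k : continuous (A k) by exact: (cintegral_orbit_average (cF k) m0').1.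
have iA k : \int[xi]_z A k z = 0 by rewrite (cintegral_orbit_average (cF k) m0').2.
have AC k z : (k < d)%N -> `|A k z| <= C.
  by move=> kd; apply: orbit_average_bound => //; exact: (fFC k kd).2.
have [I [w [P [Gw cP P0 P1 hP]]]] :=
  conditional_kernel cX cY marg cA AC (ltW C0) e10 Ceta eta1 mG muG.
pose G k x := \sum_i P i x * A k (w i, x).
have cG k : continuous (G k).
  apply: continuous_sum => i _ x; apply: cvgM; first exact: cP.
  apply: (@continuous_comp _ _ _ (fun x : Y => (w i, x)) (A k)); last exact: cA.
  have h1 : (fun _ : Y => w i) @ x --> w i by exact: (@cst_continuous Y X (w i) x).
  have h2 : (fun x : Y => x) @ x --> x by exact: cvg_id.
  exact: (cvg_pair h1 h2).
have GC k x : (k < d)%N -> `|G k x| <= C.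
  move=> kd; rewrite (le_trans (ler_norm_sum _ _ _))// -[C]mul1r -(P1 x) mulr_suml.
  by apply: ler_sum => i _; rewrite normrM (ger0_norm (P0 i x)) ler_wpM2l// AC.
have Gint k : (k < d)%N -> `|\int[nu]_x G k x| <= 3 * e1.
  by move=> kd; have := hP k kd; rewrite iA subr0.
pose Lw := (q.+1 * m)%N.
have LwE : Lw%:R = q%:R * m%:R + m%:R :> R by rewrite /Lw mulSnr natrD natrM.
have mR : 0 < m%:R :> R by rewrite ltr0n.
have Cgq : C * g%:R * q%:R <= e1 * m%:R * q%:R by rewrite ler_wpM2r.
have Cmq : C * m%:R <= e1 * q%:R * m%:R by rewrite ler_wpM2r// ltW.
have em0 : 0 <= e1 * m%:R by rewrite mulr_ge0// ltW.
exists (C * Lw%:R) => [|z t t0]; first by rewrite mulr_ge0// ltW.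
pose yy p := iter p S y; pose base tau := (t + tau * Lw)%N.
have [s [iota [sm hs]]] := joint_blocks q w yy base m0' e10 AC P0 P1.
pose K := d%:R * (2 * C * (q * m)%:R) ^+ 2 / e1.
have [k1 hk1] := quasi_generic_sum (fun k _ => cG k) Gint e10.
pose cst0 := 2 * (C * t%:R) + 2 * (C * Lw%:R) + K.
(* From here on, the costs of the initial segment, the incomplete stretch and the greedy constant
   are at most [e1] times the elapsed time. *)
pose k2 := (Num.truncn (cst0 / e1)).+1.
exists (maxn k1 (maxn t k2)) => k; rewrite !geq_max => /and3P[/hk1{hk1} hk1 tk k2k].
have nk : (k <= n_ k)%N.
  by elim: (k) => // j jn; apply: leq_ltn_trans jn _; exact: n_lt.
move: (n_ k) nk hk1 => nk kn hGy.
pose N := ((nk.+1 - t) %/ Lw)%N.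
have Lw0 : (0 < Lw)%N by rewrite /Lw muln_gt0.
pose p r := (t + (r %/ q) * Lw + s (r %/ q)%N + (r %% q) * m)%N.
have [|||r|z' [hz1 hz2]] := @shadow_blocks R X T delta M z t m g (N * q) p
  (fun r => w (iota (r %/ q)%N (r %% q)%N)) sT hM t0.
- by rewrite /m -[X in (X < _)%N]add0n ltn_add2r.
- by rewrite /m addnK.
- by rewrite /p -!addnA leq_addr.
- exact: block_starts.
have block tau j i : (tau < N)%N -> (j < q)%N -> (g <= i < m)%N ->
    mdist (iter i T (w (iota tau j))) (iter (base tau + s tau + j * m + i) T z') < delta.
  move=> tN jq im; have := hz2 (tau * q + j)%N i.
  rewrite /p divnMDl// divn_small// addn0 modnMDl modn_small//; apply=> //.
  by rewrite (@leq_trans (tau.+1 * q))// ?leq_mul2r ?tN ?orbT// mulSnr ltn_add2l.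
(* Used twice: with [f k'] composed with the first projection, and with [F k']. *)
have stretch (H : X * Y -> R) : (forall z, `|H z| <= C) ->
    (forall x x' v, mdist x x' < delta -> `|H (x, v) - H (x', v)| <= e1) ->
    forall tau, (tau < N)%N ->
    `|\sum_(n < Lw) H (iter (base tau + n) T z', yy (base tau + n)%N) -
      \sum_(j < q) \sum_(i < m) H (iter i T (w (iota tau j)),
         yy (base tau + s tau + j * m + i)%N)| <= 4 * e1 * Lw%:R.
  move=> HC Hd tau tN.
  apply: (@le_trans _ _ ((e1 * m%:R + 2 * C * g%:R) * q%:R + C * m%:R)).
    apply: (@stretch_sum _ (fun n => H (iter (base tau + n) T z', yy (base tau + n)%N))
      (fun j i => H (iter i T (w (iota tau j)), yy (base tau + s tau + j * m + i)%N))
      q m g (s tau)) => //.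
    + by rewrite /m leq_addl.
    + exact: ltnW.
    + exact: ltW.
    + exact: ltW.
    + move=> j i jq im; rewrite !addnA distrC; apply: Hd; exact: block.
  by rewrite LwE; exact: stretch_error.
exists z'; split.
- by move=> n nt; apply: lt_le_trans (hz1 n nt) _; rewrite /delta ge_min lexx.
- move=> k' n k'd tn.
  have nE : n = (n %/ Lw * Lw + n %% Lw)%N by exact: divn_eq.
  have nN : (n %/ Lw <= N)%N by apply: leq_div2r; clear -tn; lia.
  have rL : (n %% Lw < Lw)%N by exact: ltn_pmod.
  rewrite (sum_ord_divn (fun j => f k' (iter (t + j) T z')) n Lw).
  set B := \sum_(j < n %/ Lw) _; set D := \sum_(i < n %% Lw) _.
  have fC := (fFC k' k'd).1.
  (* Four units compare the stretch with its blocks, and one comes from the good averages of the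
     points [w i] over a block of length [m]. *)
  have hB : `|B| <= 5 * e1 * Lw%:R * (n %/ Lw)%:R.
    apply: (@norm_sum_le _ (fun tau => \sum_(i < Lw) f k' (iter (t + (tau * Lw + i)) T z'))).
    move=> tau tn'; have tN : (tau < N)%N by exact: leq_trans nN.
    have fd x x' (v : Y) : mdist x x' < delta -> `|f k' x - f k' x'| <= e1.
      move=> xx'; apply/ltW/(hdf k' k'd x x' v v); last by rewrite mdistxx.
      by apply: lt_le_trans xx' _; rewrite /delta !ge_min lexx !orbT.
    have hst := stretch (fun z => f k' z.1) (fun z => fC z.1) fd tau tN.
    have hgood : `|\sum_(j < q) \sum_(i < m) f k' (iter i T (w (iota tau j)))| <= e1 * m%:R * q%:R.
      apply: (@norm_sum_le _ (fun j => \sum_(i < m) f k' (iter i T (w (iota tau j))))) => j _.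
      have := Gw (iota tau j) k' k'd; rewrite if0.
      by under eq_bigr do rewrite subr0.
    have -> : \sum_(i < Lw) f k' (iter (t + (tau * Lw + i)) T z') =
        \sum_(i < Lw) f k' (iter (base tau + i) T z').
      by apply: eq_bigr => i _; rewrite addnA.
    apply: (norm_le_of_dist hst hgood).
    have -> : 5 * e1 * Lw%:R = 4 * e1 * Lw%:R + e1 * Lw%:R by ring.
    by rewrite lerD2l LwE mulrDr [q%:R * _]mulrC mulrA lerDl.
  have hD : `|D| <= C * Lw%:R.
    apply: (@le_trans _ _ (C * (n %% Lw)%:R)).
      by apply: (@norm_sum_le _ (fun i => f k' (iter (t + (n %/ Lw * Lw + i)) T z'))).
    by rewrite ler_pM2l// ler_nat ltnW.
  have hn : e1 * (Lw%:R * (n %/ Lw)%:R) <= e1 * n%:R.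
    by rewrite ler_pM2l// -natrM ler_nat {2}nE mulnC leq_addr.
  have en0 : 0 <= e1 * n%:R by rewrite mulr_ge0// ltW.
  rewrite (le_trans (ler_normD B D))// (le_trans (lerD hB hD))// lerD2r eE.
  rewrite -!mulrA; apply: (@le_trans _ _ (5 * (e1 * n%:R))); first by apply: ler_wpM2l.
  by apply: ler_wpM2r => //; rewrite ler_nat.
move=> k' k'd.
pose n := nk.+1.
have tn : (t <= n)%N by exact: leq_trans tk (leq_trans kn (leqnSn _)).
have nE : n = (t + (N * Lw + (n - t) %% Lw))%N by rewrite -divn_eq subnKC.
have rL : ((n - t) %% Lw < Lw)%N by exact: ltn_pmod.
pose a j := F k' (iter j T z', iter j S y).
have FC := (fFC k' k'd).2.
have split3 (b : nat -> R) : \sum_(j < n) b j = \sum_(j < t) b j +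
   (\sum_(tau < N) \sum_(i < Lw) b (base tau + i)%N + \sum_(i < (n - t) %% Lw) b (t + (N * Lw + i))%N).
  rewrite (sum_ord_subn b tn) (sum_ord_divn (fun i => b (t + i)%N) (n - t) Lw).
  by congr (_ + (_ + _)); apply: eq_bigr => tau _; apply: eq_bigr => i _; rewrite addnA.
have piece1 (b : nat -> R) : (forall j, `|b j| <= C) -> `|\sum_(j < t) b j| <= C * t%:R.
  by move=> bC; apply: norm_sum_le => j _; exact: bC.
have piece3 (b : nat -> R) : (forall j, `|b j| <= C) ->
    `|\sum_(i < (n - t) %% Lw) b (t + (N * Lw + i))%N| <= C * Lw%:R.
  move=> bC; apply: (@le_trans _ _ (C * ((n - t) %% Lw)%:R)).
    by apply: (@norm_sum_le _ (fun i => b (t + (N * Lw + i))%N)).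
  by rewrite ler_pM2l// ler_nat ltnW.
have aC j : `|a j| <= C by exact: FC.
have gC j : `|G k' (yy j)| <= C by exact: GC.
have := hGy k' k'd; rewrite -/n (split3 (fun j => G k' (yy j))) (split3 a).
have := piece1 _ aC; have := piece3 _ aC.
have := piece1 _ gC; have := piece3 _ gC.
set a1 := \sum_(j < t) a j; set a3 := \sum_(i < _) a _.
set g1 := \sum_(j < t) _; set g3 := \sum_(i < (n - t) %% Lw) _.
set g2 := \sum_(tau < N) _; set a2 := \sum_(tau < N) _ => g3C g1C a3C a1C hGs.
pose E tau := \sum_(j < q) \sum_(i < m) F k' (iter i T (w (iota tau j)),
         yy (base tau + s tau + j * m + i)%N).
pose Gq tau := \sum_(i < q * m) G k' (yy (base tau + i)%N).
have h1 : `|a2 - \sum_(tau < N) E tau| <= 4 * e1 * Lw%:R * N%:R.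
  rewrite /a2 -sumrB.
  apply: (@norm_sum_le _ (fun tau => \sum_(i < Lw) a (base tau + i)%N - E tau)) => tau tN.
  apply: stretch => // x x' v xx'; apply/ltW/(hdF k' k'd x x' v v); last by rewrite mdistxx.
  by apply: lt_le_trans xx' _; rewrite /delta !ge_min lexx !orbT.
have h2 : `|\sum_(tau < N) E tau - \sum_(tau < N) Gq tau| <= e1 * N%:R + K.
  rewrite -sumrB; have := hs N k' k'd.
  rewrite (_ : \sum_(tau < N) _ = \sum_(tau < N) (E tau - Gq tau))//.
  apply: eq_bigr => tau _; congr (_ - _); apply: eq_bigr => j _.
  rewrite /A mulrA mulfV ?gt_eqF// mul1r; apply: eq_bigr => i _.
  by rewrite iter_prod_map /= /yy -iterD addnC.
(* The greedy choice accounts for the first [q * m] times of each stretch; the remaining [m] are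
   bounded crudely. *)
have h3 : `|g2 - \sum_(tau < N) Gq tau| <= C * m%:R * N%:R.
  rewrite /g2 -sumrB.
  apply: (@norm_sum_le _ (fun tau => \sum_(i < Lw) G k' (yy (base tau + i)%N) - Gq tau)) => tau tN.
  have -> : \sum_(i < Lw) G k' (yy (base tau + i)%N) =
      Gq tau + \sum_(i < m) G k' (yy (base tau + (q * m + i))%N).
    rewrite -(sum_ordD (fun i => G k' (yy (base tau + i)%N))).
    by rewrite /Lw mulSnr.
  rewrite addrAC subrr add0r.
  by apply: (@norm_sum_le _ (fun i => G k' (yy (base tau + (q * m + i))%N))) => i _; exact: GC.
have NLn : (N * Lw <= n)%N by rewrite [X in (_ <= X)%N]nE addnCA leq_addr.
have NLR : e1 * (Lw%:R * N%:R) <= e1 * n%:R by rewrite ler_pM2l// -natrM ler_nat mulnC.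
have Nn : e1 * N%:R <= e1 * n%:R.
  by rewrite ler_pM2l// ler_nat (leq_trans _ NLn)// leq_pmulr.
have CmN : C * m%:R * N%:R <= e1 * (Lw%:R * N%:R).
  by rewrite mulrA ler_wpM2r// (le_trans Cmq)// LwE mulrDr mulrA lerDl.
have hcst : cst0 <= e1 * n%:R.
  rewrite mulrC -ler_pdivrMr// ltW// (lt_le_trans (truncnS_gt _))// ler_nat.
  exact: leq_trans k2k (leq_trans kn (leqnSn _)).
rewrite /cst0 in hcst; rewrite eE.
rewrite -mulrA; apply: (assemble_error g3C g1C a3C a1C _ _ h2 (le_trans h3 CmN) NLR Nn hcst).
  by rewrite (_ : 4 * (e1 * n%:R) = (3 * e1 + e1) * n%:R)//; ring.
by rewrite (_ : 4 * (e1 * (Lw%:R * N%:R)) = 4 * e1 * Lw%:R * N%:R)//; ring.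
Qed.

End Extension.

(** * The limit point *)

Lemma prefix_error (R : realType) (u v l : R) : l <= u -> u <= v -> 0 <= u ->
  u + u + (v - u + (v - u + l)) <= 5 * v.
Proof. lra. Qed.

Section Limit.
Context (R : realType) (X Y : pmetricType R) (T : X -> X) (S : Y -> Y).
Hypotheses (cX : compact [set: X]) (cY : compact [set: Y]).
Hypotheses (cT : continuous T) (cS : continuous S).
Hypothesis sT : set_surj [set: X] [set: X] T.
Variables (xi : probability (borel (X * Y)%type) R).
Variables (mu : probability (borel X) R) (nu : probability (borel Y) R).
Hypothesis ixi : invariant_measure (prod_map T S) xi.
Hypothesis marg : marginals xi mu nu.
Hypothesis hspec : weak_specification T.
Hypothesis emu : ergodic T mu.
Variables (y : Y) (n_ : nat -> nat).
Hypothesis n_lt : {homo n_ : i j / (i < j)%N}.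
Hypothesis hy : weak_star_cvg (fun k => emp R S y 0 (n_ k)) nu.

Let cXY : compact [set: X * Y].
Proof. by rewrite -setXTT; exact: compact_setX. Qed.

(** The second clause handles intermediate times of the current stage; the third supplies the prefix
    average for the next stage, without the loss [L]. *)
Definition extends (f : nat -> X -> R) (F : nat -> X * Y -> R) (d : nat) (e L : R)
    (z : X) (t : nat) (z' : X) (t' : nat) : Prop :=
  [/\ forall n, (n < t)%N -> mdist (iter n T z) (iter n T z') < e,
    forall i n, (i < d)%N -> (t + n <= t')%N ->
      `|\sum_(j < n) (f i (iter (t + j) T z') - \int[mu]_x f i x)| <= e * n%:R + L,
    forall i, (i < d)%N ->
      `|\sum_(j < t') (f i (iter j T z') - \int[mu]_x f i x)| <= e * t'%:R &
    forall i, (i < d)%N ->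
      `|\sum_(j < t') (F i (iter j T z', iter j S y) - \int[xi]_x F i x)| <= e * t'%:R].

(** After centering, the even entries of [F'] are the pair functions and the odd ones are the [f i]
    lifted by the first projection; doubling [d] controls both families up to the same time. *)
Lemma extension (f : nat -> X -> R) (F : nat -> X * Y -> R) (d : nat) (e : R) :
  (forall k, continuous (f k)) -> (forall k, continuous (F k)) -> 0 < e ->
  exists L : R, forall z t, (0 < t)%N -> exists k0, forall k, (k0 <= k)%N ->
    exists z', extends f F d e L z t z' (n_ k).+1.
Proof.
move=> cf cF e0.
have cfst : continuous (@fst X Y) by move=> z; exact: cvg_fst.
have cff i : continuous (fun z : X * Y => f i z.1).
  by move=> z; apply: continuous_comp; [exact: cfst|exact: cf].
pose f' i x := f i x - \int[mu]_x f i x.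
pose F' i z := if odd i then f i./2 z.1 - \int[mu]_x f i./2 x
  else F i./2 z - \int[xi]_x F i./2 x.
have cf' i : continuous (f' i).
  by move=> x; apply: cvgB; [exact: cf|exact: cvg_cst].
have cF' i : continuous (F' i).
  by rewrite /F'; case: (odd i) => z; apply: cvgB; try exact: cvg_cst; [exact: cff|exact: cF].
have if' i : \int[mu]_x f' i x = 0.
  rewrite cintegralB//; last by move=> x; exact: cvg_cst.
  by rewrite Rintegral_probability_cst subrr.
have iF' i : \int[xi]_x F' i x = 0.
  rewrite /F'; case: (odd i).
    rewrite (cintegralB cXY xi (cff i./2)); last by move=> x; exact: cvg_cst.
    by rewrite Rintegral_probability_cst (cintegral_comp cXY cfst (cf _) marg.1) subrr.
  rewrite cintegralB//; last by move=> x; exact: cvg_cst.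
  by rewrite Rintegral_probability_cst subrr.
have [L _ hL] := extension_normalized cX cY cT cS sT ixi marg hspec emu n_lt hy
  d.*2 cf' cF' if' iF' e0.
exists L => z t t0; have [k0 hk0] := hL z t t0; exists k0 => k kk0.
have [z' [h1 h2 h3]] := hk0 k kk0; exists z'; split=> //.
- by move=> i n id tn; apply: h2 => //; lia.
- move=> i id; have := h3 i.*2.+1; rewrite /F' /= odd_double /= uphalf_double.
  by apply; lia.
- move=> i id; have := h3 i.*2; rewrite /F' odd_double doubleK.
  by apply; lia.
Qed.

(** The successive errors form a geometric series, and compactness provides a cluster point of the
    [z k], at which the estimate persists. *)
Lemma limit_orbit (z : nat -> X) (t : nat -> nat) :
  {homo t : i j / (i <= j)%N} ->
  (forall k n, (n < t k)%N -> mdist (iter n T (z k)) (iter n T (z k.+1)) < 2^-1 ^+ k) ->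
  exists x, forall k n, (n < t k)%N ->
    mdist (iter n T (z k)) (iter n T x) <= 2 * 2^-1 ^+ k.
Proof.
move=> t_le hz.
have far k m n : (n < t k)%N ->
    mdist (iter n T (z k)) (iter n T (z (k + m)%N)) <= 2 * 2^-1 ^+ k - 2 * 2^-1 ^+ (k + m).
  move=> nt; elim: m => [|m ih]; first by rewrite addn0 mdistxx subrr.
  have nt' : (n < t (k + m)%N)%N by rewrite (leq_trans nt)// t_le// leq_addr.
  have := metric_triangle (iter n T (z k)) (iter n T (z (k + m)%N)) (iter n T (z (k + m.+1)%N)).
  by have := hz _ _ nt'; rewrite addnS exprS; lra.
have [x [_ hx]] := @cX (z @ \oo) _ filterT.
exists x => k n nt; apply/ler_addgt0Pr => e e0.
have near_x : nbhs x [set x' | mdist (iter n T x) (iter n T x') < e].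
  have ct : {for x, continuous (iter n T)} by exact: (continuous_iter cT).
  have : nbhs x (iter n T @^-1` ball (iter n T x) e) := ct _ (nbhsx_ballx _ _ e0).
  by rewrite ballEmdist.
have tail : (z @ \oo) [set x' | exists m, x' = z (k + m)%N].
  by exists k => // m /= km; exists (m - k)%N; rewrite subnKC.
have [_ [[m ->] /= xm]] := hx _ _ tail near_x.
have := far k m n nt.
have := metric_triangle (iter n T (z k)) (iter n T (z (k + m)%N)) (iter n T x).
rewrite (metric_sym (iter n T (z (k + m)%N)) (iter n T x)).
have : 0 <= 2^-1 ^+ (k + m) :> R by rewrite exprn_ge0.
lra.
Qed.

(** Stage [k] treats the first [k] test functions with tolerance [2^-1 ^+ k]. Its end time is chosen
    with the next loss [L k.+1] already known, and late enough to make that loss negligible. *)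
Lemma diagonal_sequence (f : nat -> X -> R) (F : nat -> X * Y -> R) :
  (forall k, continuous (f k)) -> (forall k, continuous (F k)) ->
  exists (L : nat -> R) (z : nat -> X) (j : nat -> nat), forall k,
    [/\ (j k < j k.+1)%N, L k.+1 <= 2^-1 ^+ k * (n_ (j k.+1)).+1%:R &
      extends f F k (2^-1 ^+ k) (L k) (z k) (n_ (j k)).+1 (z k.+1) (n_ (j k.+1)).+1].
Proof.
move=> cf cF.
have e0 k : 0 < 2^-1 ^+ k :> R by rewrite exprn_gt0.
have /choice[L hL] k := extension k cf cF (e0 k).
have /choice[next hnext] (s : nat * (X * nat)) : exists s' : X * nat,
    [/\ (s.2.2 < s'.2)%N, L s.1.+1 <= 2^-1 ^+ s.1 * (n_ s'.2).+1%:R &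
    extends f F s.1 (2^-1 ^+ s.1) (L s.1) s.2.1 (n_ s.2.2).+1 s'.1 (n_ s'.2).+1].
  case: s => k [z j] /=; have [k0 hk0] := hL k z (n_ j).+1 isT.
  pose b := (Num.truncn (L k.+1 / 2^-1 ^+ k)).+1.
  pose j' := maxn k0 (maxn j.+1 b).
  have [z' hz'] := hk0 j' (leq_maxl _ _); exists (z', j'); split=> //=.
    by rewrite /j' !leq_max leqnn !orbT.
  rewrite mulrC -ler_pdivrMr// ltW// (lt_le_trans (truncnS_gt _))// ler_nat -/b.
  have jn : (j' <= n_ j')%N.
    by elim: (j') => // i ih; apply: leq_ltn_trans ih _; exact: n_lt.
  by rewrite (leq_trans _ (leqW jn))// /j' !leq_max leqnn !orbT.
pose st := fix st k := if k is k'.+1 then next (k', st k') else (point : X, 0%N).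
by exists L, (fun k => (st k).1), (fun k => (st k).2) => k; have := hnext (k, st k).
Qed.

Lemma interval_cover (t : nat -> nat) (K : nat) : {homo t : i j / (i < j)%N} ->
  forall n, (t K <= n)%N -> exists2 k, (K <= k)%N & (t k <= n <= t k.+1)%N.
Proof.
move=> t_lt; elim=> [|n ih] tn.
  by exists K => //; rewrite tn.
move: tn; rewrite leq_eqVlt => /orP[/eqP tn|/ih[k Kk /andP[kn nk]]].
  by exists K => //; rewrite tn leqnn -tn ltnW// t_lt.
move: nk; rewrite leq_eqVlt => /orP[/eqP nk|nk]; last by exists k => //; lia.
exists k.+1; first exact: leqW.
by have := t_lt _ _ (ltnSn k.+1); lia.
Qed.

Lemma average_dist (n : nat) (a : nat -> R) (c e : R) : (0 < n)%N ->
  `|\sum_(j < n) (a j - c)| <= e * n%:R -> `|c - n%:R^-1 * \sum_(j < n) a j| <= e.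
Proof.
move=> n0; have n0' : 0 < n%:R :> R by rewrite ltr0n.
rewrite sumrB sumr_const card_ord -[c *+ n]mulr_natl => h.
rewrite distrC; have -> : n%:R^-1 * \sum_(j < n) a j - c =
    n%:R^-1 * (\sum_(j < n) a j - n%:R * c) by rewrite mulrBr mulKf// gt_eqF.
by rewrite normrM ger0_norm ?invr_ge0// mulrC ler_pdivrMr.
Qed.

Lemma generic_pair : exists x : X, generic T x mu /\ quasi_generic (prod_map T S) (x, y) xi.
Proof.
have [f cf df] := dense_span_metric cX.
have [F cF dF] := dense_span_prod cX cY.
have [L [z [j hzj]]] := diagonal_sequence cf cF.
pose t k := (n_ (j k)).+1.
have j_lt : {homo j : i k / (i < k)%N}.
  by apply: homo_ltn; [exact: ltn_trans|move=> k; have [] := hzj k].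
have t_lt : {homo t : i k / (i < k)%N} by move=> i k ik; rewrite /t ltnS; exact/n_lt/j_lt.
have t_le : {homo t : i k / (i <= k)%N}.
  by move=> i k; rewrite leq_eqVlt => /orP[/eqP ->//|ik]; exact/ltnW/t_lt.
have [x hx] := limit_orbit t_le (fun k => let: And3 _ _ (And4 h _ _ _) := hzj k in h).
have small (r : R) : 0 < r -> exists K, forall k, (K <= k)%N -> 2 * 2^-1 ^+ k < r.
  move=> r0; exists (Num.truncn (2 / r)).+1 => k kK.
  rewrite -ltr_pdivlMl// exprVn invf_plt ?posrE ?mulr_gt0 ?exprn_gt0 ?invr_gt0//.
  rewrite invfM invrK; apply: (lt_le_trans (truncnS_gt _)).
  apply: (@le_trans _ _ k%:R); first by rewrite ler_nat.
  by rewrite -natrX ler_nat ltnW// ltn_expl.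
exists x; split.
  apply: (weak_star_cvg_dense cX cf df) => i; apply/cvgrPdist_le => e e0.
  have e5 : 0 < e / 5 by rewrite divr_gt0.
  have [delta delta0 hdelta] := compact_uniformly_continuous cX (cf i) e5.
  have [K1 hK1] := small _ delta0; have [K2 hK2] := small _ e5.
  pose K := maxn i.+1 (maxn K1 K2).
  exists (t K.+1) => // n /= tn; rewrite (cintegral_emp cX)//.
  apply: (@average_dist n.+1 (fun m => f i (iter m T x))) => //.
  (* The time lies between the ends of stages [k] and [k.+1]: stage [k] controls the prefix up to
     [t k.+1], stage [k.+1] the rest. *)
  have [[//|k] Kk /andP[kn nk]] := interval_cover t_lt (leqW tn).
  have : (K <= k)%N by exact: Kk.
  rewrite /K !geq_max => /and3P[ik K1k K2k].
  move: (n.+1) kn nk => {tn}n kn nk.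
  have [_ Lk [_ _ h3 _]] := hzj k; have [_ _ [_ h2 _ _]] := hzj k.+1.
  have sk : 2^-1 ^+ k <= e / 5.
    have := hK2 k K2k; have : 0 <= 2^-1 ^+ k :> R by rewrite exprn_ge0.
    lra.
  have sk1 : 2^-1 ^+ k.+1 <= e / 5 by apply: le_trans sk; rewrite exprS ler_piMl ?exprn_ge0//; lra.
  have close m k' : (k <= k')%N -> (m < t k')%N ->
      `|f i (iter m T x) - f i (iter m T (z k'))| <= e / 5.
    move=> kk' mt; apply/ltW/hdelta; rewrite ballEmdist /= metric_sym.
    by apply: le_lt_trans (hx _ _ mt) _; apply: hK1; exact: leq_trans K1k kk'.
  have := h3 i ik.
  have := h2 i (n - t k.+1)%N (leqW ik); rewrite subnKC// => /(_ nk).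
  rewrite -/(t k.+1).
  set c := \int[mu]_x f i x.
  set B := \sum_(j0 < _) _ => hB; set A := \sum_(j0 < _) _ => hA.
  (* Before [t k.+1] the orbit of [x] is compared with that of [z k.+1], afterwards with that of
     [z k.+2]; [A] and [B] are the centered sums along those orbits. *)
  have -> : \sum_(m < n) (f i (iter m T x) - c) =
    (\sum_(m < t k.+1) (f i (iter m T x) - f i (iter m T (z k.+1))) + A) +
    (\sum_(m < n - t k.+1) (f i (iter (t k.+1 + m) T x) - f i (iter (t k.+1 + m) T (z k.+2))) + B).
    rewrite (sum_ord_subn (fun m => f i (iter m T x) - c) kn) /A /B -!big_split/=.
    by congr (_ + _); apply: eq_bigr => m _; ring.
  have hC : `|\sum_(m < t k.+1) (f i (iter m T x) - f i (iter m T (z k.+1)))| <= e / 5 * (t k.+1)%:R.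
    by apply: (@norm_sum_le _ (fun m => f i (iter m T x) - f i (iter m T (z k.+1)))) => m mt;
      exact: close.
  have hD : `|\sum_(m < n - t k.+1) (f i (iter (t k.+1 + m) T x) -
      f i (iter (t k.+1 + m) T (z k.+2)))| <= e / 5 * (n - t k.+1)%:R.
    apply: (@norm_sum_le _ (fun m => f i (iter (t k.+1 + m) T x) - f i (iter (t k.+1 + m) T (z k.+2)))) => m mt.
    apply: close; first exact: leqW (leqnSn k).
    by rewrite (leq_trans _ nk)// -ltn_subRL.
  have hL : L k.+1 <= e / 5 * (t k.+1)%:R by apply: le_trans Lk _; rewrite ler_wpM2r.
  have hA' : `|A| <= e / 5 * (t k.+1)%:R by apply: le_trans hA _; rewrite ler_wpM2r.
  have hB' : `|B| <= e / 5 * (n - t k.+1)%:R + L k.+1.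
    by apply: le_trans hB _; rewrite lerD2r ler_wpM2r.
  rewrite natrB// in hD hB'.
  have tn : e / 5 * (t k.+1)%:R <= e / 5 * n%:R by rewrite ler_pM2l// ler_nat.
  have t0 : 0 <= e / 5 * (t k.+1)%:R by rewrite mulr_ge0// ltW.
  rewrite (le_trans (ler_normD _ _))//.
  rewrite (le_trans (lerD (ler_normD _ _) (ler_normD _ _)))//.
  rewrite (le_trans (lerD (lerD hC hA') (lerD hD hB')))//.
  rewrite mulrBr (_ : e * n%:R = 5 * (e / 5 * n%:R)); last by field.
  exact: prefix_error.
(* These are the stage end times, where the last clause of [extends] applies; [emp] up to
   [n_ (j k.+1)] averages over [t k.+1] points. *)
exists (fun k => n_ (j k.+1)); split.
  by move=> i k ik; apply/n_lt/j_lt.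
apply: (weak_star_cvg_dense cXY cF dF) => i; apply/cvgrPdist_le => e e0.
have e2 : 0 < e / 2 by rewrite divr_gt0.
have [delta delta0 hdelta] := compact_uniformly_continuous cXY (cF i) e2.
have [K1 hK1] := small _ delta0; have [K2 hK2] := small _ e2.
exists (maxn i.+1 (maxn K1 K2)) => // k /=; rewrite !geq_max => /and3P[ik K1k K2k].
rewrite (cintegral_emp cXY)//.
apply: (@average_dist (t k.+1) (fun m => F i (iter m (prod_map T S) (x, y)))) => //.
have [_ _ [_ _ _ h4]] := hzj k; have := h4 i ik; rewrite -/(t k.+1).
set A := \sum_(j0 < _) _ => hA.
have -> : \sum_(m < t k.+1) (F i (iter m (prod_map T S) (x, y)) - \int[xi]_x F i x) =
    \sum_(m < t k.+1) (F i (iter m T x, iter m S y) - F i (iter m T (z k.+1), iter m S y)) + A.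
  by rewrite /A -big_split/=; apply: eq_bigr => m _; rewrite iter_prod_map; ring.
have sk : 2^-1 ^+ k <= e / 2.
  have := hK2 k K2k; have : 0 <= 2^-1 ^+ k :> R by rewrite exprn_ge0.
  lra.
rewrite (le_trans (ler_normD _ _))// [e in e * _]splitr mulrDl lerD//.
  apply: (@norm_sum_le _ (fun m => F i (iter m T x, iter m S y) - F i (iter m T (z k.+1), iter m S y))).
  move=> m mt; apply/ltW/hdelta; split; rewrite /= ballEmdist/= ?mdistxx// metric_sym.
  by apply: le_lt_trans (hx _ _ mt) _; apply: hK1; exact: leqW.
by apply: le_trans hA _; rewrite ler_wpM2r.
Qed.

End Limit.

Theorem theorem1p3 (R : realType) (X Y : pmetricType R)
  (T : X -> X) (S : Y -> Y)
  (hT : tds T) (hS : tds S)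
  (xi : probability (borel (X * Y)%type) R)
  (mu : probability (borel X) R) (nu : probability (borel Y) R)
  (hxi : invariant_measure (prod_map T S) xi)
  (hmarg : marginals xi mu nu)
  (hspec : weak_specification T)
  (hmu : ergodic T mu)
  (y : Y) (hy : quasi_generic S y nu) :
  exists x : X, generic T x mu /\ quasi_generic (prod_map T S) (x, y) xi.
Proof.
have [cX cT sT] := hT; have [cY cS _] := hS; have [n_ [n_lt ny]] := hy.
exact: (generic_pair cX cY cT cS sT hxi hmarg hspec hmu n_lt ny).
Qed.
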